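(* Let $a<b$ and $n\ge1$. Let $Z_1:[a,b]\to\mathbb{R}^{q_1\times n}$ and $Z_2:[a,b]\times[a,b]\to\mathbb{R}^{q_2\times n}$ be square-integrable, let $g:[a,b]\to\mathbb{R}$ satisfy $g(s)\ge0$ for all $s\in[a,b]$, and let $$P=\begin{bmatrix}P_{11}&P_{12}&P_{13}\\P_{21}&P_{22}&P_{23}\\P_{31}&P_{32}&P_{33}\end{bmatrix}\ge0$$ be a symmetric positive semidefinite real matrix, partitioned with block sizes $q_1,q_2,q_2$. Suppose $$M(s)=g(s)Z_1(s)^TP_{11}Z_1(s),$$ $$N_1(s,\theta)=g(s)Z_1(s)^TP_{12}Z_2(s,\theta)+g(\theta)Z_2(\theta,s)^TP_{31}Z_1(\theta)+\int_a^\theta g(\nu)Z_2(\nu,s)^TP_{33}Z_2(\nu,\theta)\,d\nu+\int_\theta^sg(\nu)Z_2(\nu,s)^TP_{32}Z_2(\nu,\theta)\,d\nu+\int_s^bg(\nu)Z_2(\nu,s)^TP_{22}Z_2(\nu,\theta)\,d\nu,$$ $$N_2(s,\theta)=g(s)Z_1(s)^TP_{13}Z_2(s,\theta)+g(\theta)Z_2(\theta,s)^TP_{21}Z_1(\theta)+\int_a^sg(\nu)Z_2(\nu,s)^TP_{33}Z_2(\nu,\theta)\,d\nu+\int_s^\theta g(\nu)Z_2(\nu,s)^TP_{23}Z_2(\nu,\theta)\,d\nu+\int_\theta^bg(\nu)Z_2(\nu,s)^TP_{22}Z_2(\nu,\theta)\,d\nu .$$ Then $\langle x,\mathcal{P}_{\{M,N_1,N_2\}}x\rangle_{L_2}\ge0$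 for all $x\in L_2^n[a,b]$.
   Context: For functions $M:[a,b]\to\mathbb{R}^{n\times n}$ and $N_1,N_2:[a,b]^2\to\mathbb{R}^{n\times n}$, $\mathcal{P}_{\{M,N_1,N_2\}}$ denotes the operator $L_2^n[a,b]\to L_2^n[a,b]$ given by $$(\mathcal{P}_{\{M,N_1,N_2\}}x)(s)=M(s)x(s)+\int_a^sN_1(s,\theta)x(\theta)\,d\theta+\int_s^bN_2(s,\theta)x(\theta)\,d\theta;$$ it is part of this convention that the data ($g$, $Z_1$, $Z_2$, hence $M,N_1,N_2$) are such that the integrals exist and this is a well-defined bounded operator on $L_2^n[a,b]$ (in the intended use $g$, $Z_1$, $Z_2$ are polynomials). $L_2^n[a,b]$ carries the inner product $\langle x,y\rangle_{L_2}=\int_a^bx(s)^Ty(s)\,ds$. *)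

(* Defs.v *)
(* Library: MathComp and MathComp-Analysis. *)
From HB Require Import structures.
From mathcomp Require Import all_boot all_order all_algebra.
From mathcomp Require Import all_classical all_reals all_analysis.

Set Implicit Arguments.
Unset Strict Implicit.
Unset Printing Implicit Defensive.

Import Order.TTheory GRing.Theory Num.Theory.
Import numFieldNormedType.Exports.

Local Open Scope classical_set_scope.
Local Open Scope ring_scope.

(* Functions on [a, b] or [a, b]^2 are represented by total functions on R or
   R * R; only their values on [a, b] or [a, b]^2 are ever constrained. *)

Definition mxintegrable (R : realType) (m n : nat) (D : set R)
    (F : R -> 'M[R]_(m, n)) : Prop :=
  forall i j, (@lebesgue_measure R).-integrable D (fun t => (F t i j)%:E).

Definition mxint (R : realType) (m n : nat) (D : set R)
    (F : R -> 'M[R]_(m, n)) : 'M[R]_(m, n) :=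
  \matrix_(i, j) \int[@lebesgue_measure R]_(t in D) F t i j.

(* Restriction by zero turns L_2 of a measurable set into the library's L_2 of
   the whole space. *)
Definition mxL2 (R : realType) (m n : nat) (a b : R)
    (F : R -> 'M[R]_(m, n)) : Prop :=
  forall i j, (fun t => F t i j) \_ `[a, b] \in Lfun (@lebesgue_measure R) 2%:E.

Definition mxL2_square (R : realType) (m n : nat) (a b : R)
    (F : R -> R -> 'M[R]_(m, n)) : Prop :=
  forall i j, (fun p : R * R => F p.1 p.2 i j) \_ (`[a, b] `*` `[a, b]) \in
    Lfun (@lebesgue_measure R \x @lebesgue_measure R)%E 2%:E.

(* The elements of L_2^n[a, b] are handled through representatives
   x : R -> 'cV[R]_n with mxL2 a b x; the inner product and the norm below do
   not depend on the representative. *)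
Definition L2inner (R : realType) (n : nat) (a b : R)
    (x y : R -> 'cV[R]_n) : R :=
  \int[@lebesgue_measure R]_(s in `[a, b]) ((x s)^T *m y s) ord0 ord0.

Definition L2norm (R : realType) (n : nat) (a b : R) (x : R -> 'cV[R]_n) : R :=
  Num.sqrt (L2inner a b x x).

(* Only the values N1 s t with t <= s and N2 s t with s <= t are used. *)
Definition PIop (R : realType) (n : nat) (a b : R) (M : R -> 'M[R]_n)
    (N1 N2 : R -> R -> 'M[R]_n) (x : R -> 'cV[R]_n) (s : R) : 'cV[R]_n :=
  M s *m x s + mxint `[a, s] (fun t => N1 s t *m x t)
             + mxint `[s, b] (fun t => N2 s t *m x t).

(* The integrals defining PIop are total in Rocq, hence the explicit almost
   everywhere existence clause. *)
Definition PIop_bounded (R : realType) (n : nat) (a b : R) (M : R -> 'M[R]_n)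
    (N1 N2 : R -> R -> 'M[R]_n) : Prop :=
  (forall x : R -> 'cV[R]_n, mxL2 a b x ->
     {ae @lebesgue_measure R, forall s, s \in `[a, b] ->
        mxintegrable `[a, s] (fun t => N1 s t *m x t) /\
        mxintegrable `[s, b] (fun t => N2 s t *m x t)} /\
     mxL2 a b (PIop a b M N1 N2 x)) /\
  (exists C : R, forall x : R -> 'cV[R]_n, mxL2 a b x ->
     L2norm a b (PIop a b M N1 N2 x) <= C * L2norm a b x).

Definition psdmx (R : realType) (m : nat) (A : 'M[R]_m) : Prop :=
  A^T = A /\ forall v : 'cV[R]_m, 0 <= (v^T *m A *m v) ord0 ord0.

Definition block3_mx (R : realType) (q1 q2 : nat)
    (P11 : 'M[R]_q1) (P12 P13 : 'M[R]_(q1, q2))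
    (P21 : 'M[R]_(q2, q1)) (P22 P23 : 'M[R]_q2)
    (P31 : 'M[R]_(q2, q1)) (P32 P33 : 'M[R]_q2) : 'M[R]_(q1 + (q2 + q2)) :=
  block_mx P11 (row_mx P12 P13)
           (col_mx P21 P31) (block_mx P22 P23 P32 P33).

(* Main.v *)
Require Import Defs.
From HB Require Import structures.
From mathcomp Require Import all_boot all_order all_algebra.
From mathcomp Require Import all_classical all_reals all_analysis.
From mathcomp Require Import measurable_realfun ring lra.

(* Factor P = L^T L with L = [L1 L2 L3]. With h(v) = sqrt(g v) L1 Z1(v) x(v), with
   k(v, s) = sqrt(g v) L2 Z2(v, s) x(s) for s < v and sqrt(g v) L3 Z2(v, s) x(s) for
   v <= s, and with K(v) the integral of k(v, s) over s, exchanging the integrals turns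
   the form into the integral of |h(v) + K(v)|^2 over v.
   As g may be unbounded, the exchange needs care.  At s = t the hypotheses say that
   k(., s) is square integrable for every s, so it is legitimate once x is cut down to
   the set where |h(s)|^2 + \int |k(v, s)|^2 dv is at most l.  These truncations tend
   to x in L_2 as l grows, and the operator is bounded, so the inequality passes to the limit. *)

Set Implicit Arguments.
Unset Strict Implicit.
Unset Printing Implicit Defensive.

Import Order.TTheory GRing.Theory Num.Theory.
Import numFieldNormedType.Exports.

Local Open Scope classical_set_scope.
Local Open Scope ring_scope.

(** * Factorization of positive semidefinite matrices *)

(** The function [x] is truncated rather than [g]: cutting [g] down would change [M], [N1] and [N2],
    whereas boundedness is known for the given operator only. Truncating [x] keeps the operator and,
    as h(v) and k(v, s) are linear in x(v) and x(s), merely zeroes h and the columns k(., s) outside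
    the chosen set. In return the columns are bounded in L_2 uniformly in s; since [a, b] has finite
    measure, k is then square integrable on the square, which is what Fubini needs for the products
    k(v, s) k(v, t). Each row of L gives a scalar problem, and the rows are added only at the
    end. *)

Lemma quad_expand (R : realType) (m q : nat) (A : 'M[R]_(m, q)) (u : 'cV[R]_m)
    (v : 'cV[R]_q) :
  (u^T *m A *m v) ord0 ord0 = \sum_i \sum_j u i ord0 * A i j * v j ord0.
Proof.
rewrite !mxE exchange_big /=; apply: eq_bigr => j _.
by rewrite !mxE big_distrl /=; apply: eq_bigr => i _; rewrite !mxE.
Qed.

(** At t = -(p + 1) / q the value would be -1. This settles two degenerate cases: a zero pivot in
    the factorization, and a function of norm zero in the Cauchy-Schwarz inequality. *)
Lemma affine_ge0_slope0 (R : realType) (p q : R) :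
  (forall t, 0 <= p + t * q) -> q = 0.
Proof.
move=> H; apply/eqP/negPn/negP => q0.
have := H (- (p + 1) / q); rewrite mulfVK//; lra.
Qed.

Lemma trmx11 (R : realType) (A : 'M[R]_1) : A^T = A.
Proof. by apply/matrixP => i j; rewrite !mxE !ord1. Qed.

(** Cholesky factorization by induction on the size, splitting off the first row. A zero pivot [al]
    forces the row [r] to vanish; a positive one leaves the Schur complement, which is again
    positive semidefinite. *)
Lemma psdmx_factor (R : realType) (m : nat) (P : 'M[R]_m) :
  psdmx P -> exists L : 'M[R]_m, P = L^T *m L.
Proof.
elim: m P => [|m IH] P [Psym Ppos].
  by exists 0; apply/matrixP => -[].
pose P' : 'M[R]_(1 + m) := P.
have {}Psym : P'^T = P' by [].
have {}Ppos : forall v : 'cV_(1 + m), 0 <= (v^T *m P' *m v) ord0 ord0 by [].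
rewrite -[P]/(P'); move: P' Psym Ppos => {}P.
rewrite -(submxK P); move: (ulsubmx P) (ursubmx P) (dlsubmx P) (drsubmx P).
move=> a r r' S; rewrite tr_block_mx => /eq_block_mx[_ r'E <- Ssym].
move=> Ppos.
suff [L LE] : exists L : 'M[R]_(1 + m), block_mx a r r^T S = L^T *m L by exists L.
set al := a ord0 ord0.
have aE : a = al%:M by rewrite {1}[a]mx11_scalar.
have key (t : R) (w : 'cV_m) :
  0 <= t ^+ 2 * al + (t * (r *m w) ord0 ord0) *+ 2 + (w^T *m S *m w) ord0 ord0.
  have := Ppos (col_mx t%:M w).
  rewrite tr_col_mx mul_row_block mul_row_col mulmxDl mulmxDl.
  rewrite tr_scalar_mx aE !mul_scalar_mx -!scalemxAl !mul_mx_scalar.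
  have -> : w^T *m r^T = (r *m w) by rewrite -trmx_mul trmx11.
  rewrite !mxE/= !mulr1n mulr2n; lra.
have al0 : 0 <= al.
  have := key 1 0; rewrite !mulmx0 !mxE expr1n mulr0 mul0rn; lra.
have [al_eq0|al_neq0] := eqVneq al 0.
- have r0 : r = 0.
    apply/matrixP => i j; rewrite ord1 [RHS]mxE {i}.
    (* With a zero pivot the form is affine in t, and on the j-th basis vector its slope is twice
       the entry [r ord0 j]; t is halved below to absorb the 2. *)
    pose w : 'cV[R]_m := delta_mx j ord0.
    have rw : (r *m w) ord0 ord0 = r ord0 j.
      rewrite -colE mxE. by [].
    apply: (@affine_ge0_slope0 _ ((w^T *m S *m w) ord0 ord0)) => t.
    have := key (t / 2) w; rewrite al_eq0 rw mulr0 mulr2n; lra.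
  have [L SE] : exists L : 'M[R]_m, S = L^T *m L.
    apply: IH; split => // v.
    by have := key 0 v; rewrite expr0n/= !mul0r mul0rn !add0r.
  exists (block_mx (0 : 'M[R]_1) (0 : 'rV[R]_m) 0 L).
  rewrite tr_block_mx mulmx_block !trmx0 !(mul0mx, mulmx0) !(add0r, addr0).
  by rewrite -SE aE al_eq0 r0 trmx0 raddf0.
- pose s := Num.sqrt al.
  have sE : s * s = al by rewrite -expr2 sqr_sqrtr.
  have s0 : s != 0 by rewrite sqrtr_eq0 -ltNge lt_def al_neq0.
  have [L SE] : exists L : 'M[R]_m, S - al^-1 *: (r^T *m r) = L^T *m L.
    apply: IH; split.
      by rewrite linearB linearZ/= Ssym trmx_mul trmxK.
    move=> v.
    (* This t minimises the polynomial of [key]; the minimum is the Schur complement evaluated at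
       v. *)
    have := key (- (r *m v) ord0 ord0 / al) v.
    rewrite mulmxBr mulmxBl -scalemxAr -scalemxAl.
    have -> : v^T *m (r^T *m r) *m v = (r *m v)^T *m (r *m v).
      by rewrite trmx_mul !mulmxA.
    have -> : (v^T *m S *m v - al^-1 *: ((r *m v)^T *m (r *m v))) ord0 ord0 =
       (v^T *m S *m v) ord0 ord0 - al^-1 * ((r *m v) ord0 ord0 * (r *m v) ord0 ord0).
      by rewrite trmx11 mxE [X in _ + X]mxE [X in _ - X]mxE [(_ *m (r *m v)) _ _]mxE big_ord1.
    set z := (r *m v) ord0 ord0.
    suff -> : (- z / al) ^+ 2 * al + (- z / al * z) *+ 2 = - (al^-1 * (z * z)) by lra.
    by rewrite mulr2n; field.
  exists (block_mx (s%:M : 'M[R]_1) (s^-1 *: r) 0 L).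
  rewrite tr_block_mx mulmx_block !trmx0 !(mul0mx, mulmx0) !(addr0).
  have -> : (s^-1 *: r)^T = s^-1 *: r^T by rewrite linearZ.
  rewrite -SE tr_scalar_mx !mul_scalar_mx !mul_mx_scalar !scalerA mulfV// !scale1r.
  by rewrite -scalemxAl -scalemxAr scalerA -invfM scale_scalar_mx sE addrC subrK aE.
Qed.

(** * Square integrable kernels *)

Lemma normrM_le_sqrD (R : realType) (x y : R) : `|x * y| <= x ^+ 2 + y ^+ 2.
Proof.
by rewrite ler_norml; apply/andP; split; have := sqr_ge0 (x - y);
  have := sqr_ge0 (x + y); nra.
Qed.

(** Measurability of f is a separate conjunct because that of its square does not imply it. For
    Lebesgue measure this is membership in L_2, by [square_integrable_Lfun]. *)
Definition square_integrable d (T : measurableType d) (R : realType)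
    (mu : {measure set T -> \bar R}) (f : T -> R) : Prop :=
  measurable_fun setT f /\ mu.-integrable setT (fun x => (f x ^+ 2)%:E).

Lemma square_integrableM d (T : measurableType d) (R : realType)
    (mu : {measure set T -> \bar R}) (f g : T -> R) :
  square_integrable mu f -> square_integrable mu g ->
  mu.-integrable setT (fun x => (f x * g x)%:E).
Proof.
move=> [mf if2] [mg ig2].
apply: (le_integrable measurableT _ _ (integrableD measurableT if2 ig2)).
  by apply/measurable_EFinP; exact: measurable_funM.
move=> x _ /=; rewrite lee_fin [leRHS]ger0_norm ?addr_ge0 ?sqr_ge0//.
exact: normrM_le_sqrD.
Qed.

Lemma ae_eq_Rintegral d (T : measurableType d) (R : realType)
    (mu : {measure set T -> \bar R}) (D : set T) (f g : T -> R) :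
  measurable D -> measurable_fun D f -> measurable_fun D g ->
  {ae mu, forall x, D x -> f x = g x} ->
  \int[mu]_(x in D) f x = \int[mu]_(x in D) g x.
Proof.
move=> mD mf mg fg; congr fine; apply: ae_eq_integral => //.
- exact/measurable_EFinP.
- exact/measurable_EFinP.
- by apply: filterS fg => x fgx Dx /=; rewrite fgx.
Qed.

(** * Fubini's theorem for real-valued integrals *)

Section fubini_real.
Context d1 d2 (T1 : measurableType d1) (T2 : measurableType d2) (R : realType).
Variables (m1 : {sigma_finite_measure set T1 -> \bar R})
  (m2 : {sigma_finite_measure set T2 -> \bar R}) (f : T1 * T2 -> R).
Hypothesis intf : (m1 \x m2)%E.-integrable setT (EFin \o f).

Let integrable_fubini_G : m2.-integrable setT (fubini_G m1 (EFin \o f)).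
Proof.
have mf := measurable_int _ intf.
apply/integrableP; split; first exact: (measurable_fubini_G intf).
apply: le_lt_trans ((integrable21ltyP m1 m2 mf).1 intf).
apply: ge0_le_integral => //.
- by apply: measurableT_comp => //; exact: (measurable_fubini_G intf).
- apply: (@measurable_fun_fubini_tonelli_G _ _ _ _ _ m1 (abse \o (EFin \o f))).
    exact: measurableT_comp.
  by move=> y; exact: abse_ge0.
- move=> y _; apply: le_abse_integral => //.
  exact: (measurable_fun_pair1 y mf).
Qed.

(** An inner integral may be infinite at some points, where [fine] replaces it by 0. Integrability
    makes these points negligible, so the outer integral does not change. *)
Let fineF d (T : measurableType d) (m : {measure set T -> \bar R}) F :
  m.-integrable setT F ->
  m.-integrable setT (fun x => (fine (F x))%:E) /\
  (\int[m]_x (fine (F x))%:E = \int[m]_x F x)%E.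
Proof.
move=> iF; have mF := measurable_int _ iF.
have mfF : measurable_fun setT (fun x => (fine (F x))%:E).
  by apply/measurable_EFinP; exact: measurableT_comp.
split.
  by apply: le_integrable iF => // x _; case: (F x) => //=; rewrite normr0 leey.
apply: ae_eq_integral => //.
by apply: filterS (integrable_ae measurableT iF) => x /= H _; rewrite fineK ?H.
Qed.

Lemma integrable_Rintegral1 :
  m1.-integrable setT (fun x => (\int[m2]_y f (x, y))%:E).
Proof. by have [] := fineF (integrable_fubini_F intf). Qed.

Lemma integrable_Rintegral2 :
  m2.-integrable setT (fun y => (\int[m1]_x f (x, y))%:E).
Proof. by have [] := fineF integrable_fubini_G. Qed.

Lemma Rintegral_swap :
  \int[m1]_x \int[m2]_y f (x, y) = \int[m2]_y \int[m1]_x f (x, y).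
Proof.
congr fine.
have [_ ->] := fineF (integrable_fubini_F intf).
have [_ ->] := fineF integrable_fubini_G.
exact: Fubini.
Qed.

End fubini_real.

Section square_integrable_kernel.
Context d (T : measurableType d) (R : realType).
Variables (mu : {sigma_finite_measure set T -> \bar R}) (D : set T).
Hypotheses (mD : measurable D) (Doo : (mu D < +oo)%E).
Variable k : T -> T -> R.
Hypothesis k2 : square_integrable (mu \x mu)%E (fun p => k p.1 p.2).
Hypothesis kD : forall v s, ~ D s -> k v s = 0.

Let mk : measurable_fun setT (fun p : T * T => k p.1 p.2) := k2.1.

(** Finiteness of mu D makes h(v)^2, constant in s, integrable over s in D. Together with k^2 it
    dominates k h in [integrable_kernelM], where k vanishes for s outside D. *)
Let ind2 h : square_integrable mu h ->
  (mu \x mu)%E.-integrable setT (fun p => (h p.1 ^+ 2 * \1_D p.2)%:E).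
Proof.
move=> [mh ih].
have m : measurable_fun setT (fun p : T * T => (h p.1 ^+ 2 * \1_D p.2)%:E).
  apply/measurable_EFinP/measurable_funM.
    by apply: measurable_funX; exact: measurableT_comp.
  exact: measurableT_comp.
apply/(integrable12ltyP mu mu m) => /=.
rewrite (eq_integral (fun x => ((h x ^+ 2)%:E * mu D)%E)); last first.
  move=> x _; rewrite (eq_integral (fun y => ((h x ^+ 2)%:E * (\1_D y)%:E)%E)).
    rewrite ge0_integralZl ?lee_fin ?sqr_ge0//; last exact/measurable_EFinP.
    by rewrite integral_indic// setIT.
  by move=> y _; rewrite ger0_norm// mulr_ge0 ?sqr_ge0 ?indicE ?ler0n.
have D0 : (0 <= fine (mu D)) by rewrite fine_ge0.
have muD : mu D = (fine (mu D))%:E by rewrite fineK// ge0_fin_numE.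
rewrite muD ge0_integralZr//.
- apply: lte_mul_pinfty; rewrite ?lee_fin//.
  + by apply: integral_ge0 => x _; rewrite lee_fin sqr_ge0.
  + by rewrite ge0_fin_numE ?integrable_lty// integral_ge0// => x _; rewrite lee_fin sqr_ge0.
  + by rewrite ltry.
- exact: measurable_int ih.
- by move=> x _; rewrite lee_fin sqr_ge0.
Qed.

Lemma integrable_kernelM h : square_integrable mu h ->
  (mu \x mu)%E.-integrable setT (fun p => (k p.1 p.2 * h p.1)%:E).
Proof.
move=> h2; apply: (le_integrable measurableT _ _ (integrableD measurableT k2.2 (ind2 h2))).
  apply/measurable_EFinP/measurable_funM => //.
  by apply: measurableT_comp => //; exact: h2.1.
move=> -[v s] _ /=; rewrite lee_fin.
have [Ds|nDs] := pselect (D s); last by rewrite kD// mul0r normr0.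
rewrite indicE mem_set// mulr1 [leRHS]ger0_norm ?addr_ge0 ?sqr_ge0//.
exact: normrM_le_sqrD.
Qed.

Let integrable_indicD : mu.-integrable setT (fun x => (\1_D x)%:E).
Proof.
apply/integrableP; split; first exact/measurable_EFinP.
rewrite (eq_integral (fun x => (\1_D x)%:E)) ?integral_indic ?setIT//.
by move=> x _; rewrite gee0_abs.
Qed.

Lemma square_integrable_indic : square_integrable mu (\1_D : T -> R).
Proof.
split; first by [].
apply: eq_integrable integrable_indicD => //.
by move=> x _; rewrite indicE; case: (_ \in _); rewrite ?expr1n ?expr0n.
Qed.

Lemma ae_square_integrable_section :
  {ae mu, forall v, square_integrable mu (k v)}.
Proof.
apply: filterS (ae_integrable1 k2.2) => v kv2; split => //.
exact: measurable_fun_pair2 mk.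
Qed.

Lemma integrable_section v : square_integrable mu (k v) ->
  mu.-integrable setT (fun s => (k v s)%:E).
Proof.
move=> kv2; apply: eq_integrable (square_integrableM kv2 square_integrable_indic) => //.
move=> s _; rewrite indicE; have [Ds|nDs] := pselect (D s).
  by rewrite mem_set// mulr1.
by rewrite kD// mul0r.
Qed.

Hypothesis kD1 : forall v s, ~ D v -> k v s = 0.

Let K v := \int[mu]_s k v s.

Let integrablek : (mu \x mu)%E.-integrable setT (fun p => (k p.1 p.2)%:E).
Proof.
apply: eq_integrable (integrable_kernelM square_integrable_indic) => //.
move=> -[v s] _ /=; rewrite indicE; have [Dv|nDv] := pselect (D v).
  by rewrite mem_set// mulr1.
by rewrite kD1// mul0r.
Qed.

(* The integral of (k v s - l 1_D(s))^2 over s is nonnegative for l = K v / c; the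
   added 1 keeps c positive when D is negligible. *)
Let intK2 v : square_integrable mu (k v) ->
  K v ^+ 2 <= (fine (mu D) + 1) * \int[mu]_s (k v s ^+ 2).
Proof.
move=> kv2; set c := fine (mu D) + 1.
have D0 : 0 <= fine (mu D) by rewrite fine_ge0.
have c0 : 0 < c by rewrite ltr_wpDl.
have ikv := integrable_section kv2.
have H l : 0 <= \int[mu]_s (k v s ^+ 2) - 2 * l * K v + l ^+ 2 * fine (mu D).
  have -> : fine (mu D) = \int[mu]_s \1_D s by rewrite /Rintegral integral_indic// setIT.
  have -> : 2 * l * K v = \int[mu]_s (2 * l * k v s) by rewrite RintegralZl.
  have -> : l ^+ 2 * \int[mu]_s \1_D s = \int[mu]_s (l ^+ 2 * \1_D s :> R).
    by rewrite RintegralZl.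
  have i1 : mu.-integrable setT (fun s => (2 * l * k v s)%:E).
    exact: (integrableZl measurableT (2 * l) ikv).
  have i2 : mu.-integrable setT (fun s => (l ^+ 2 * \1_D s)%:E).
    exact: (integrableZl measurableT (l ^+ 2) integrable_indicD).
  have i3 : mu.-integrable setT (fun s => (k v s ^+ 2 - 2 * l * k v s)%:E).
    exact: (integrableB measurableT kv2.2 i1).
  rewrite -RintegralB//; last exact: kv2.2.
  rewrite -RintegralD//; apply: Rintegral_ge0 => s _.
  rewrite indicE; have [Ds|nDs] := pselect (D s).
    by rewrite mem_set// mulr1; have := sqr_ge0 (k v s - l); lra.
  by rewrite kD// memNset// !mulr0 expr0n/= subr0 addr0.
have := H (K v / c); set I2 := Rintegral _ _ _.
have -> : I2 - 2 * (K v / c) * K v + (K v / c) ^+ 2 * fine (mu D) =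
   I2 - K v ^+ 2 / c - (K v / c) ^+ 2.
  rewrite (_ : fine (mu D) = c - 1); last by rewrite /c addrK.
  by field; rewrite gt_eqF.
move=> H1; rewrite -ler_pdivrMl// mulrC.
by have := sqr_ge0 (K v / c); lra.
Qed.

(** The bound [intK2] holds for almost every v, namely where the row k(v, .) is square integrable;
    integrating it in v gives the claim. *)
Lemma square_integrable_Rintegral : square_integrable mu K.
Proof.
have iK : mu.-integrable setT (fun v => (K v)%:E) by exact: integrable_Rintegral1 integrablek.
have mK : measurable_fun setT K by apply/measurable_EFinP; exact: measurable_int iK.
split => //.
have ik2 := integrable_Rintegral1 k2.2.
pose G v := (fine (mu D) + 1) * \int[mu]_s (k v s ^+ 2).
have iG : mu.-integrable setT (fun v => (G v)%:E).
  exact: (integrableZl measurableT (fine (mu D) + 1) ik2).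
have mK2 : measurable_fun setT (fun v => (K v ^+ 2)%:E).
  by apply/measurable_EFinP; exact: measurable_funX.
apply/integrableP; split => //.
have G0 v : 0 <= G v.
  apply: mulr_ge0; first by rewrite addr_ge0 ?fine_ge0.
  by apply: Rintegral_ge0 => s _; exact: sqr_ge0.
apply: le_lt_trans (integrable_lty measurableT iG).
apply: ae_ge0_le_integral => //.
- exact: measurableT_comp.
- by move=> v _; rewrite lee_fin.
- exact: measurable_int iG.
apply: filterS ae_square_integrable_section => v kv2 _.
by rewrite /= lee_fin ger0_norm ?sqr_ge0//; exact: intK2.
Qed.

Section against.
Variable h : T -> R.
Hypothesis h2 : square_integrable mu h.

(** Three choices of [h] occur later: the diagonal term, K itself, and, for fixed s, the column k(.,
    s). *)
Lemma integrable_kernel_against :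
  mu.-integrable setT (fun s => (\int[mu]_v (k v s * h v))%:E).
Proof. exact: integrable_Rintegral2 (integrable_kernelM h2). Qed.

Lemma Rintegral_kernel_swap :
  \int[mu]_s \int[mu]_v (k v s * h v) = \int[mu]_v (K v * h v).
Proof.
rewrite -(Rintegral_swap (integrable_kernelM h2)); apply: ae_eq_Rintegral => //.
- by apply/measurable_EFinP; exact: measurable_int (integrable_Rintegral1 (integrable_kernelM h2)).
- by apply: measurable_funM; [exact: square_integrable_Rintegral.1|exact: h2.1].
apply: filterS ae_square_integrable_section => v kv2 _ /=.
by rewrite RintegralZr//; exact: integrable_section.
Qed.

End against.

End square_integrable_kernel.

(** * The quadratic form of a scalar kernel with uniformly bounded columns *)

Section kernel_form.
Context d (T : measurableType d) (R : realType).
Variables (mu : {sigma_finite_measure set T -> \bar R}) (D : set T).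
Hypotheses (mD : measurable D) (Doo : (mu D < +oo)%E).
Variables (h : T -> R) (k : T -> T -> R).
Hypothesis h2 : square_integrable mu h.
Hypothesis mk : measurable_fun setT (fun p : T * T => k p.1 p.2).
Hypothesis kD2 : forall v s, ~ D s -> k v s = 0.
Hypothesis kD1 : forall v s, ~ D v -> k v s = 0.
Hypothesis k2s : forall s, square_integrable mu (k ^~ s).
Variable c : R.
Hypothesis k2c : forall s, \int[mu]_v (k v s ^+ 2) <= c.

(** Integrating in v before s bounds the double integral of k^2 by |c| mu(D). The absolute value is
    there because the sign of [c] is not prescribed. *)
Let k2 : square_integrable (mu \x mu)%E (fun p => k p.1 p.2).
Proof.
split => //.
have mk2 : measurable_fun setT (fun p : T * T => (k p.1 p.2 ^+ 2)%:E).
  by apply/measurable_EFinP; exact: measurable_funX.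
apply/(integrable21ltyP mu mu mk2) => /=.
have c0 : 0 <= `|c| by [].
apply: (@le_lt_trans _ _ (\int[mu]_s (`|c|%:E * (\1_D s)%:E))%E); last first.
  rewrite ge0_integralZl//; last exact/measurable_EFinP.
  rewrite integral_indic// setIT; apply: lte_mul_pinfty => //.
apply: ge0_le_integral => //.
- by move=> s _; exact: integral_ge0.
- apply: (@measurable_fun_fubini_tonelli_G _ _ _ _ _ mu
    (abse \o (fun p => (k p.1 p.2 ^+ 2)%:E))); first exact: measurableT_comp.
  by move=> y; exact: abse_ge0.
- by apply/measurable_EFinP; exact: measurable_funM.
move=> s _; rewrite indicE; have [Ds|nDs] := pselect (D s); last first.
  rewrite integral0_eq ?mule_ge0 ?lee_fin//.
  by move=> v _ /=; rewrite kD2// expr0n normr0.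
rewrite mem_set// mule1.
rewrite (eq_integral (fun v => (k v s ^+ 2)%:E)); last first.
  by move=> v _; rewrite ger0_norm// sqr_ge0.
rewrite -(fineK (integrable_fin_num measurableT (k2s s).2)) lee_fin.
exact: le_trans (k2c s) (ler_norm _).
Qed.

Let K v := \int[mu]_t k v t.

Let K2 : square_integrable mu K.
Proof. exact: (square_integrable_Rintegral mD Doo k2 kD2 kD1). Qed.

(* F is introduced because s |-> \int n s t dt is only known to agree almost everywhere
   with a measurable function. *)
Lemma kernel_form_ge0 :
  let n s t := h s * k s t + k t s * h t + \int[mu]_v (k v s * k v t) in
  exists F : T -> R, [/\ mu.-integrable setT (fun s => (F s)%:E),
    0 <= \int[mu]_s F s &
    {ae mu, forall s, mu.-integrable setT (fun t => (n s t)%:E) /\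
       h s ^+ 2 + \int[mu]_t n s t = F s}].
Proof.
move=> n.
pose A s := h s * K s.
pose B s := \int[mu]_t (k t s * h t).
pose C s := \int[mu]_v (k v s * K v).
have ih2 := h2.2.
have iA : mu.-integrable setT (fun s => (A s)%:E) by exact: square_integrableM.
have iB : mu.-integrable setT (fun s => (B s)%:E).
  exact: (integrable_kernel_against mD Doo k2 kD2 h2).
have iC : mu.-integrable setT (fun s => (C s)%:E).
  exact: (integrable_kernel_against mD Doo k2 kD2 K2).
have iKK := K2.2.
exists (fun s => h s ^+ 2 + (A s + B s + C s)).
have iAB := integrableD measurableT iA iB.
have iABC := integrableD measurableT iAB iC.
split.
- exact: (integrableD measurableT ih2 iABC).
- rewrite RintegralD// RintegralD// RintegralD//.
  rewrite (Rintegral_kernel_swap mD Doo k2 kD2 kD1 h2).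
  rewrite (Rintegral_kernel_swap mD Doo k2 kD2 kD1 K2).
  have iKh : mu.-integrable setT (fun s => (K s * h s)%:E) by exact: square_integrableM.
  have iKK' : mu.-integrable setT (fun s => (K s * K s)%:E) by exact: square_integrableM.
  rewrite -RintegralD// -RintegralD//; last exact: (integrableD measurableT iA iKh).
  rewrite -RintegralD//; last first.
    exact: (integrableD measurableT (integrableD measurableT iA iKh) iKK').
  apply: Rintegral_ge0 => s _.
  rewrite -[leRHS]/(h s ^+ 2 + (h s * K s + K s * h s + K s * K s)).
  by have := sqr_ge0 (h s + K s); lra.
(* Only the term h(s) k(s, t) restricts s, since it needs the row k(s, .) to be integrable. The
   other two terms rely on the columns, which are square integrable for every s. *)
apply: filterS (ae_square_integrable_section k2) => s ks2.
have iks := integrable_section mD Doo kD2 ks2.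
have i1 : mu.-integrable setT (fun t => (h s * k s t)%:E).
  exact: (integrableZl measurableT (h s) iks).
have i2 : mu.-integrable setT (fun t => (k t s * h t)%:E) by exact: square_integrableM.
have i3 : mu.-integrable setT (fun t => (\int[mu]_v (k v s * k v t))%:E).
  under eq_fun do under eq_Rintegral do rewrite mulrC.
  exact: (integrable_kernel_against mD Doo k2 kD2 (k2s s)).
have i12 := integrableD measurableT i1 i2.
split; first exact: (integrableD measurableT i12 i3).
rewrite RintegralD// RintegralD// RintegralZl//; congr (_ + (_ + _)).
(* For fixed s the exchange is applied with the column k(., s) in the role of [h]. *)
transitivity (\int[mu]_v (K v * k v s)).
  rewrite -(Rintegral_kernel_swap mD Doo k2 kD2 kD1 (k2s s)).
  by apply: eq_Rintegral => t _; apply: eq_Rintegral => v _; exact: mulrC.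
by apply: eq_Rintegral => v _; exact: mulrC.
Qed.

End kernel_form.

(** * Integrals over adjacent intervals *)

Lemma integrable_sumr d (T : measurableType d) (R : realType)
    (mu : {measure set T -> \bar R}) (D : set T) (I : Type) (s : seq I)
    (f : I -> T -> R) : measurable D ->
  (forall i, mu.-integrable D (fun x => (f i x)%:E)) ->
  mu.-integrable D (fun x => (\sum_(i <- s) f i x)%:E).
Proof.
move=> mD fi; under eq_fun do rewrite -sumEFin.
exact: integrable_sum.
Qed.

Lemma Rintegral_sum d (T : measurableType d) (R : realType)
    (mu : {measure set T -> \bar R}) (D : set T) (I : Type) (s : seq I)
    (f : I -> T -> R) : measurable D ->
  (forall i, mu.-integrable D (fun x => (f i x)%:E)) ->
  \int[mu]_(x in D) (\sum_(i <- s) f i x) = \sum_(i <- s) \int[mu]_(x in D) f i x.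
Proof.
move=> mD fi; elim: s => [|i s IH].
  rewrite big_nil; under eq_Rintegral do rewrite big_nil.
  by rewrite Rintegral_cst// mul0r.
rewrite big_cons -IH -RintegralD//; [|exact: fi|exact: integrable_sumr].
by apply: eq_Rintegral => x _; rewrite big_cons.
Qed.

Section interval_splitting.
Context (R : realType).
Notation mu := (@lebesgue_measure R).

(** Agreement is required on the open interval only, endpoints being negligible. At v = s, for
    instance, [form_kernel] takes the [L3] branch while the adjacent integral over [s, b] is written
    with [L2]. *)
Lemma eq_Rintegral_itvoo (a b : R) (f g : R -> R) : a <= b ->
  measurable_fun setT f -> mu.-integrable `[a, b] (fun t => (g t)%:E) ->
  (forall t, a < t < b -> f t = g t) ->
  mu.-integrable `[a, b] (fun t => (f t)%:E) /\
  \int[mu]_(t in `[a, b]) f t = \int[mu]_(t in `[a, b]) g t.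
Proof.
move=> ab mf ig fg.
have mg : measurable_fun `]a, b[ g.
  have /measurable_EFinP := measurable_int _ ig.
  apply: measurable_funS => //; exact: subset_itvW.
split.
  apply/integrableP; split; first exact/measurable_EFinP/measurable_funTS.
  case/integrableP: ig => _.
  rewrite /= -(@eq_integral_itv_bounded _ a b (fun t => `|g t|) (fun t => `|f t|)) //.
  - by apply: measurableT_comp => //; exact: measurable_funTS.
  - exact: measurableT_comp.
  - by move=> t; rewrite in_itv/= => /fg ->.
congr fine; apply: eq_integral_itv_bounded => //; first exact: measurable_funTS.
Qed.

Lemma Rintegral_itv_split (a c b : R) (f f1 f2 : R -> R) : a <= c -> c <= b ->
  measurable_fun setT f ->
  mu.-integrable `[a, c] (fun t => (f1 t)%:E) ->
  mu.-integrable `[c, b] (fun t => (f2 t)%:E) ->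
  (forall t, a < t < c -> f t = f1 t) -> (forall t, c < t < b -> f t = f2 t) ->
  mu.-integrable `[a, b] (fun t => (f t)%:E) /\
  \int[mu]_(t in `[a, b]) f t =
    \int[mu]_(t in `[a, c]) f1 t + \int[mu]_(t in `[c, b]) f2 t.
Proof.
move=> ac cb mf i1 i2 e1 e2.
have [if1 <-] := eq_Rintegral_itvoo ac mf i1 e1.
have [if2 <-] := eq_Rintegral_itvoo cb mf i2 e2.
have itvU : `[a, b]%classic = `[a, c] `|` `]c, b].
  by rewrite -itv_bndbnd_setU// bnd_simp.
have if2' : mu.-integrable `]c, b] (fun t => (f t)%:E).
  apply: integrableS if2 => // y /=.
  by rewrite !in_itv/= => /andP[/ltW -> ->].
have disj : [disjoint `[a, c]%classic & `]c, b]%classic].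
  apply/disj_setPS => y [/=]; rewrite 2!in_itv/= => /andP[_ yx] /andP[].
  by rewrite ltNge yx.
have ifab : mu.-integrable `[a, b] (fun t => (f t)%:E).
  apply/integrableP; split; first exact/measurable_EFinP/measurable_funTS.
  rewrite itvU ge0_integral_setU//.
  - by case/integrableP: if1 => _ ?; case/integrableP: if2' => _ ?; rewrite lte_add_pinfty.
  - by apply/measurable_EFinP; apply: measurableT_comp => //; exact: measurable_funTS.
split => //.
rewrite itvU Rintegral_setU//; last by rewrite -itvU.
by rewrite (Rintegral_itv_obnd_cbnd if2').
Qed.

Lemma Rintegral_itv_split3 (a c d b : R) (f f1 f2 f3 : R -> R) :
  a <= c -> c <= d -> d <= b -> measurable_fun setT f ->
  (forall t, ~ `[a, b]%classic t -> f t = 0) ->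
  mu.-integrable `[a, c] (fun t => (f1 t)%:E) ->
  mu.-integrable `[c, d] (fun t => (f2 t)%:E) ->
  mu.-integrable `[d, b] (fun t => (f3 t)%:E) ->
  (forall t, a < t < c -> f t = f1 t) -> (forall t, c < t < d -> f t = f2 t) ->
  (forall t, d < t < b -> f t = f3 t) ->
  \int[mu]_t f t = \int[mu]_(t in `[a, c]) f1 t + \int[mu]_(t in `[c, d]) f2 t
    + \int[mu]_(t in `[d, b]) f3 t.
Proof.
move=> ac cd db mf f0 i1 i2 i3 e1 e2 e3.
have -> : \int[mu]_t f t = \int[mu]_(t in `[a, b]) f t.
  rewrite [RHS]Rintegral_mkcond; congr Rintegral; apply/funext => t.
  rewrite patchE; case: ifPn => //; rewrite notin_setE; exact: f0.
have [icb E] := Rintegral_itv_split cd db mf i2 i3 e2 e3.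
have cb := le_trans cd db.
by have [_ ->] := Rintegral_itv_split ac cb mf i1 icb e1 (fun _ _ => erefl); rewrite E addrA.
Qed.

End interval_splitting.

(** Both square roots enter here: that of the matrix gives one product for each row of L, and that
    of [g] shares the weight between the two factors. *)
Lemma bilin_block (R : realType) (p q q' n n' : nat) (L : 'M[R]_(p, q))
    (L' : 'M[R]_(p, q')) (Z : 'M[R]_(q, n)) (Z' : 'M[R]_(q', n'))
    (x : 'cV[R]_n)
    (x' : 'cV[R]_n') (g : R) : 0 <= g ->
  (x^T *m (g *: (Z^T *m (L^T *m L') *m Z')) *m x') ord0 ord0 =
  \sum_i (Num.sqrt g * (L *m (Z *m x)) i ord0) *
         (Num.sqrt g * (L' *m (Z' *m x')) i ord0).
Proof.
move=> g0; rewrite -scalemxAr -scalemxAl mxE.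
have -> : x^T *m (Z^T *m (L^T *m L') *m Z') *m x' =
    (L *m (Z *m x))^T *m (L' *m (Z' *m x')).
  by rewrite !trmx_mul !mulmxA.
rewrite mxE big_distrr /=; apply: eq_bigr => i _.
by rewrite [in LHS]mxE mulrACA -expr2 sqr_sqrtr.
Qed.

Lemma bilin_mxint (R : realType) (m n : nat) (D : set R) (F : R -> 'M[R]_(m, n))
    (x : 'cV[R]_m) (y : 'cV[R]_n) : measurable D -> mxintegrable D F ->
  (@lebesgue_measure R).-integrable D (fun t => ((x^T *m F t *m y) ord0 ord0)%:E) /\
  (x^T *m mxint D F *m y) ord0 ord0 =
  \int[@lebesgue_measure R]_(t in D) (x^T *m F t *m y) ord0 ord0.
Proof.
move=> mD iF.
have ix i j : (@lebesgue_measure R).-integrable D (fun t => (x i ord0 * F t i j)%:E).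
  by under eq_fun do rewrite EFinM; apply: integrableZl => //; exact: iF.
have iij i j : (@lebesgue_measure R).-integrable D
    (fun t => (x i ord0 * F t i j * y j ord0)%:E).
  by under eq_fun do rewrite EFinM; apply: integrableZr => //; exact: ix.
have ii i : (@lebesgue_measure R).-integrable D
    (fun t => (\sum_j x i ord0 * F t i j * y j ord0)%:E) by exact: integrable_sumr.
under eq_fun do rewrite quad_expand.
split; first exact: integrable_sumr.
under eq_Rintegral do rewrite quad_expand.
rewrite quad_expand Rintegral_sum//; apply: eq_bigr => i _.
rewrite Rintegral_sum//; apply: eq_bigr => j _.
by rewrite !mxE RintegralZr ?RintegralZl//; [exact: iF|exact: ix].
Qed.

(** * The quadratic form of a truncated function *)

Definition measurable_mx d (T : measurableType d) (R : realType) (m n : nat)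
    (F : T -> 'M[R]_(m, n)) : Prop :=
  forall i j, measurable_fun setT (fun t => F t i j).

(* The conditions on M, N1 and N2 when the (i, j) block of P is Li^T *m Lj. *)
Definition square_form_data (R : realType) (a b : R) (n q1 q2 p : nat)
    (Z1 : R -> 'M[R]_(q1, n)) (Z2 : R -> R -> 'M[R]_(q2, n)) (g : R -> R)
    (L1 : 'M[R]_(p, q1)) (L2 L3 : 'M[R]_(p, q2))
    (M : R -> 'M[R]_n) (N1 N2 : R -> R -> 'M[R]_n) : Prop :=
  [/\ forall s, a <= s <= b -> M s = g s *: ((Z1 s)^T *m (L1^T *m L1) *m Z1 s),
      forall s t, a <= t -> t <= s -> s <= b ->
        [/\ mxintegrable `[a, t]
              (fun v => g v *: ((Z2 v s)^T *m (L3^T *m L3) *m Z2 v t)),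
            mxintegrable `[t, s]
              (fun v => g v *: ((Z2 v s)^T *m (L3^T *m L2) *m Z2 v t)) &
            mxintegrable `[s, b]
              (fun v => g v *: ((Z2 v s)^T *m (L2^T *m L2) *m Z2 v t))],
      forall s t, a <= s -> s <= t -> t <= b ->
        [/\ mxintegrable `[a, s]
              (fun v => g v *: ((Z2 v s)^T *m (L3^T *m L3) *m Z2 v t)),
            mxintegrable `[s, t]
              (fun v => g v *: ((Z2 v s)^T *m (L2^T *m L3) *m Z2 v t)) &
            mxintegrable `[t, b]
              (fun v => g v *: ((Z2 v s)^T *m (L2^T *m L2) *m Z2 v t))],
      forall s t, a <= t -> t <= s -> s <= b ->
        N1 s t =
          g s *: ((Z1 s)^T *m (L1^T *m L2) *m Z2 s t)
          + g t *: ((Z2 t s)^T *m (L3^T *m L1) *m Z1 t)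
          + mxint `[a, t] (fun v => g v *: ((Z2 v s)^T *m (L3^T *m L3) *m Z2 v t))
          + mxint `[t, s] (fun v => g v *: ((Z2 v s)^T *m (L3^T *m L2) *m Z2 v t))
          + mxint `[s, b] (fun v => g v *: ((Z2 v s)^T *m (L2^T *m L2) *m Z2 v t)) &
      forall s t, a <= s -> s <= t -> t <= b ->
        N2 s t =
          g s *: ((Z1 s)^T *m (L1^T *m L3) *m Z2 s t)
          + g t *: ((Z2 t s)^T *m (L2^T *m L1) *m Z1 t)
          + mxint `[a, s] (fun v => g v *: ((Z2 v s)^T *m (L3^T *m L3) *m Z2 v t))
          + mxint `[s, t] (fun v => g v *: ((Z2 v s)^T *m (L2^T *m L3) *m Z2 v t))
          + mxint `[t, b] (fun v => g v *: ((Z2 v s)^T *m (L2^T *m L2) *m Z2 v t))].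

Section square_form.
Context (R : realType) (a b : R) (n q1 q2 p : nat).
Variables (Z1 : R -> 'M[R]_(q1, n)) (Z2 : R -> R -> 'M[R]_(q2, n)) (g : R -> R).
Variables (L1 : 'M[R]_(p, q1)) (L2 L3 : 'M[R]_(p, q2)).
Variable x : R -> 'cV[R]_n.
Notation mu := (@lebesgue_measure R).

Definition form_diag (i : 'I_p) (v : R) : R :=
  Num.sqrt (g v) * (L1 *m (Z1 v *m x v)) i ord0.

(** Adding [form_diag] to the integral of this kernel over s gives sqrt(g(v)) times [L1 L2 L3]
    applied to the stacked vector of Z1(v) x(v), the integral of Z2(v, s) x(s) over s < v, and the
    one over s > v. *)
Definition form_kernel (i : 'I_p) (v s : R) : R :=
  Num.sqrt (g v) * ((if s < v then L2 else L3) *m (Z2 v s *m x s)) i ord0.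

Variables (M : R -> 'M[R]_n) (N1 N2 : R -> R -> 'M[R]_n).
Hypothesis hg : forall s, 0 <= g s.
Hypothesis hg0 : forall s, ~ (a <= s <= b) -> g s = 0.
Hypothesis hx0 : forall s, ~ (a <= s <= b) -> x s = 0.
Hypothesis data : square_form_data a b Z1 Z2 g L1 L2 L3 M N1 N2.
Variable c : R.
Hypothesis h2 : forall i, square_integrable mu (form_diag i).
Hypothesis mk : forall i, measurable_fun setT
  (fun p : measurableTypeR R * measurableTypeR R => form_kernel i p.1 p.2).
Hypothesis k2s : forall i s, square_integrable mu (form_kernel i ^~ s).
Hypothesis k2c : forall i s, \int[mu]_v (form_kernel i v s ^+ 2) <= c.

Notation h := form_diag.
Notation k := form_kernel.

Let add11 (A B : 'M[R]_1) : (A + B) ord0 ord0 = A ord0 ord0 + B ord0 ord0.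
Proof. by rewrite mxE. Qed.

Let kg0 i v s : ~ (a <= v <= b) -> k i v s = 0.
Proof. by move=> nv; rewrite /k hg0// sqrtr0 mul0r. Qed.

Let kx0 i v s : ~ (a <= s <= b) -> k i v s = 0.
Proof. by move=> ns; rewrite /k hx0// !mulmx0 mxE mulr0. Qed.

Let hg00 i v : ~ (a <= v <= b) -> h i v = 0.
Proof. by move=> nv; rewrite /h hg0// sqrtr0 mul0r. Qed.

Let ikk i s t : mu.-integrable setT (fun v => (k i v s * k i v t)%:E).
Proof. exact: square_integrableM. Qed.

Let mkk s t : measurable_fun setT (fun v => \sum_i k i v s * k i v t).
Proof.
apply/measurable_EFinP; apply: (measurable_int mu).
by apply: integrable_sumr => // i; exact: ikk.
Qed.

Let kernel i s t := h i s * k i s t + k i t s * h i t + \int[mu]_v (k i v s * k i v t).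

(** For t < s the two points cut [a, b] into three intervals in v. The branches taken by k(v, s) and
    k(v, t) are [L3] and [L3], then [L3] and [L2], then [L2] and [L2]: the blocks 33, 32 and 22 of
    [N1]. For s < t the middle pair is [L2] and [L3], which is the block 23 of [N2]. *)
Let kernelE1 s t : a <= t -> t < s -> s <= b ->
  ((x s)^T *m N1 s t *m x t) ord0 ord0 = \sum_i kernel i s t.
Proof.
move=> at_ ts sb; have ts' := ltW ts.
have [_ hint1 _ hN1 _] := data.
have [i1 i2 i3] := hint1 _ _ at_ ts' sb.
rewrite hN1// !mulmxDr !mulmxDl !add11.
rewrite !big_split/= -!addrA; congr (_ + (_ + _)).
- by rewrite bilin_block//; apply: eq_bigr => i _; rewrite /h /k ts.
- by rewrite bilin_block//; apply: eq_bigr => i _; rewrite /h /k ltNge ts'.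
have [j1 E1] := bilin_mxint (x s) (x t) (measurable_itv _) i1.
have [j2 E2] := bilin_mxint (x s) (x t) (measurable_itv _) i2.
have [j3 E3] := bilin_mxint (x s) (x t) (measurable_itv _) i3.
apply: (etrans (congr2 +%R E1 (congr2 +%R E2 E3))) => {E1 E2 E3}.
rewrite -Rintegral_sum//.
rewrite addrA; apply/esym; apply: (Rintegral_itv_split3 at_ ts' sb (mkk s t) _ j1 j2 j3).
- by move=> v nv; apply: big1 => i _; rewrite (kg0 i s) ?mul0r.
- move=> v /andP[av vt]; rewrite bilin_block//; apply: eq_bigr => i _.
  by rewrite /k ltNge (ltW (lt_trans vt ts)) /= ltNge (ltW vt).
- move=> v /andP[tv vs]; rewrite bilin_block//; apply: eq_bigr => i _.
  by rewrite /k ltNge (ltW vs) /= tv.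
- move=> v /andP[sv vb]; rewrite bilin_block//; apply: eq_bigr => i _.
  by rewrite /k sv (lt_trans ts sv).
Qed.

Let kernelE2 s t : a <= s -> s < t -> t <= b ->
  ((x s)^T *m N2 s t *m x t) ord0 ord0 = \sum_i kernel i s t.
Proof.
move=> as_ st tb; have st' := ltW st.
have [_ _ hint2 _ hN2] := data.
have [i1 i2 i3] := hint2 _ _ as_ st' tb.
rewrite hN2// !mulmxDr !mulmxDl !add11.
rewrite !big_split/= -!addrA; congr (_ + (_ + _)).
- by rewrite bilin_block//; apply: eq_bigr => i _; rewrite /h /k ltNge st'.
- by rewrite bilin_block//; apply: eq_bigr => i _; rewrite /h /k st.
have [j1 E1] := bilin_mxint (x s) (x t) (measurable_itv _) i1.
have [j2 E2] := bilin_mxint (x s) (x t) (measurable_itv _) i2.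
have [j3 E3] := bilin_mxint (x s) (x t) (measurable_itv _) i3.
apply: (etrans (congr2 +%R E1 (congr2 +%R E2 E3))) => {E1 E2 E3}.
rewrite -Rintegral_sum//.
rewrite addrA; apply/esym; apply: (Rintegral_itv_split3 as_ st' tb (mkk s t) _ j1 j2 j3).
- by move=> v nv; apply: big1 => i _; rewrite (kg0 i s) ?mul0r.
- move=> v /andP[av vs]; rewrite bilin_block//; apply: eq_bigr => i _.
  by rewrite /k ltNge (ltW vs) /= ltNge (ltW (lt_trans vs st)).
- move=> v /andP[sv vt]; rewrite bilin_block//; apply: eq_bigr => i _.
  by rewrite /k sv ltNge (ltW vt).
- move=> v /andP[tv vb]; rewrite bilin_block//; apply: eq_bigr => i _.
  by rewrite /k tv (lt_trans st tv).
Qed.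

Let y := PIop a b M N1 N2 x.

Hypothesis mx : measurable_mx x.
Hypothesis my : forall i, measurable_fun `[a, b] (fun s => y s i ord0).
Hypothesis hae : {ae mu, forall s, s \in `[a, b] ->
  mxintegrable `[a, s] (fun t => N1 s t *m x t) /\
  mxintegrable `[s, b] (fun t => N2 s t *m x t)}.

Let integrandE s : a <= s <= b ->
  (forall i, mu.-integrable setT (fun t => (kernel i s t)%:E)) ->
  mxintegrable `[a, s] (fun t => N1 s t *m x t) ->
  mxintegrable `[s, b] (fun t => N2 s t *m x t) ->
  ((x s)^T *m y s) ord0 ord0 = \sum_i (h i s ^+ 2 + \int[mu]_t kernel i s t).
Proof.
move=> /[dup] sab /andP[as_ sb] ik iN1 iN2.
rewrite /y /PIop !mulmxDr !add11.
rewrite big_split/= -addrA; congr (_ + _).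
  have [hM _ _ _ _] := data.
  by rewrite hM// mulmxA bilin_block//; apply: eq_bigr.
(* The integrands of the operator are columns, so the right-hand vector of [bilin_mxint] is taken to
   be the 1 by 1 identity. *)
have [j1 E1] := bilin_mxint (x s) 1%:M (measurable_itv _) iN1.
have [j2 E2] := bilin_mxint (x s) 1%:M (measurable_itv _) iN2.
have {}E1 := etrans (congr1 (fun A : 'cV_1 => A ord0 ord0) (esym (mulmx1 _))) E1.
have {}E2 := etrans (congr1 (fun A : 'cV_1 => A ord0 ord0) (esym (mulmx1 _))) E2.
apply: (etrans (congr2 +%R E1 E2)) => {E1 E2}.
rewrite -Rintegral_sum//.
have mks : measurable_fun setT (fun t => \sum_i kernel i s t).
  by apply/measurable_EFinP; apply: (measurable_int mu); exact: integrable_sumr.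
(* The point t = s lies in neither open interval, so the strict cases [kernelE1] and [kernelE2]
   suffice. *)
have [||_ <-] // := Rintegral_itv_split as_ sb mks j1 j2.
- by move=> t /andP[at_ ts]; rewrite mulmx1 mulmxA kernelE1// ltW.
- by move=> t /andP[at_ ts]; rewrite mulmx1 mulmxA kernelE2// ltW.
rewrite Rintegral_mkcond; congr Rintegral; apply/funext => t.
rewrite patchE; case: ifPn => //; rewrite notin_setE/= in_itv/= => nt.
apply/esym/big1 => i _.
rewrite /kernel (kx0 i s nt) (hg00 i nt) !mulr0 !add0r.
transitivity (\int[mu]_(v in setT) (0 : R)); last by rewrite Rintegral_cst// mul0r.
by apply: eq_Rintegral => v _; rewrite (kx0 i v nt) mulr0.
Qed.

Lemma square_form_ge0 : 0 <= L2inner a b x y.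
Proof.
have H i : exists F : R -> R, [/\ mu.-integrable setT (fun s => (F s)%:E),
    0 <= \int[mu]_s F s &
    {ae mu, forall s, mu.-integrable setT (fun t => (kernel i s t)%:E) /\
       h i s ^+ 2 + \int[mu]_t kernel i s t = F s}].
  have Doo : (mu `[a, b]%classic < +oo)%E.
    by rewrite lebesgue_measure_itv/=; case: ifP => // _; rewrite -EFinB ltry.
  have K1 v s : ~ `[a, b]%classic s -> k i v s = 0.
    by move=> ns; apply: kx0 => sab; apply: ns; rewrite /= in_itv.
  have K2 v s : ~ `[a, b]%classic v -> k i v s = 0.
    by move=> nv; apply: kg0 => vab; apply: nv; rewrite /= in_itv.
  exact: (@kernel_form_ge0 _ _ _ mu `[a, b]%classic (measurable_itv `[a, b]) Doo
    (h i) (k i) (h2 i) (mk i) K1 K2 (k2s i) c (k2c i)).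
have [F HF] := choice H.
have iF i : mu.-integrable setT (fun s => (F i s)%:E) by have [] := HF i.
have aeF : {ae mu, forall s, forall i, mu.-integrable setT (fun t => (kernel i s t)%:E) /\
       h i s ^+ 2 + \int[mu]_t kernel i s t = F i s}.
  by apply: filter_forall => i; have [] := HF i.
have ms : measurable_fun setT (fun s => \sum_i F i s).
  by apply/measurable_EFinP; apply: (measurable_int mu); exact: integrable_sumr.
have FE : {ae mu, forall s, `[a, b]%classic s ->
    ((x s)^T *m y s) ord0 ord0 = \sum_i F i s}.
  apply: (@filterS2 _ _ (ae_filter_ringOfSetsType mu) _ _ _ _ aeF hae) => s Fs Hs /=.
  rewrite in_itv/= => sab.
  have [iN1 iN2] := Hs sab.
  rewrite integrandE//; last by move=> i; have [] := Fs i.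
  by apply: eq_bigr => i _; have [] := Fs i.
have mxy : measurable_fun `[a, b] (fun s => ((x s)^T *m y s) ord0 ord0).
  rewrite (_ : (fun _ => _) = (fun s => \sum_i x s i ord0 * y s i ord0)).
    by apply: measurable_sum => i; apply: measurable_funM => //; exact: measurable_funTS.
  by apply/funext => s; rewrite mxE; apply: eq_bigr => i _; rewrite mxE.
have -> : L2inner a b x y = \int[mu]_(s in `[a, b]) (\sum_i F i s).
  by apply: ae_eq_Rintegral => //; exact: measurable_funTS.
(* The nonnegative integrals of F run over the whole line. For s outside [a, b] both h and the
   kernel vanish, hence so does F almost everywhere there. *)
rewrite Rintegral_mkcond.
have -> : \int[mu]_s ((fun s => \sum_i F i s) \_ `[a, b]) s = \int[mu]_s (\sum_i F i s).
  apply: ae_eq_Rintegral => //.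
    by apply/measurable_restrict => //; exact: measurable_funTS.
  apply: (@filterS _ _ (ae_filter_ringOfSetsType mu) _ _ _ aeF) => s Fs _.
  rewrite patchE; case: ifPn => //; rewrite notin_setE/= in_itv/= => ns.
  apply/esym/big1 => i _; have [_ <-] := Fs i.
  have h0 := hg00 i ns.
  transitivity (0 ^+ 2 + \int[mu]_(t in setT) (0 : R)).
    rewrite h0; congr (_ + _); apply: eq_Rintegral => t _; rewrite /kernel h0 (kg0 i t ns).
    rewrite (kx0 i t ns) !mul0r !add0r.
    transitivity (\int[mu]_(v in setT) (0 : R)).
      by apply: eq_Rintegral => v _; rewrite (kx0 i v ns) mul0r.
    by rewrite Rintegral_cst// mul0r.
  by rewrite Rintegral_cst// mul0r addr0 expr0n.
rewrite Rintegral_sum//; apply: sumr_ge0 => i _.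
by have [] := HF i.
Qed.

End square_form.

(** * The inner product and truncation *)

Lemma integrableZlr d (T : measurableType d) (R : realType)
    (mu : {measure set T -> \bar R}) (D : set T) (r : R) (f : T -> R) :
  measurable D -> mu.-integrable D (fun x => (f x)%:E) ->
  mu.-integrable D (fun x => (r * f x)%:E).
Proof. by move=> mD; exact: integrableZl. Qed.

Lemma integrableDr d (T : measurableType d) (R : realType)
    (mu : {measure set T -> \bar R}) (D : set T) (f g : T -> R) :
  measurable D -> mu.-integrable D (fun x => (f x)%:E) ->
  mu.-integrable D (fun x => (g x)%:E) ->
  mu.-integrable D (fun x => (f x + g x)%:E).
Proof. by move=> mD; exact: integrableD. Qed.

Section limit.
Context (R : realType) (a b : R) (n : nat).
Notation mu := (@lebesgue_measure R).

Lemma square_integrable_Lfun (f : R -> R) :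
  square_integrable mu f <-> f \in Lfun mu 2%:E.
Proof.
split=> [[mf if2]|f2].
  rewrite inE; apply/andP; split; rewrite inE//=.
  rewrite /finite_norm unlock poweR_lty//=.
  under eq_integral do rewrite powR_mulrn// real_normK ?num_real//.
  case/integrableP : if2 => _; congr (_ < _)%E; apply: eq_integral => t _.
  by rewrite /= ger0_norm ?sqr_ge0.
split; last exact: Lfun2_integrable_sqr.
by move: f2; rewrite inE => /andP[]; rewrite inE.
Qed.

Lemma mxL2_integrableM (m m' q q' : nat) (F : R -> 'M[R]_(m, q)) (G : R -> 'M[R]_(m', q'))
    i j i' j' : mxL2 a b F -> mxL2 a b G ->
  mu.-integrable `[a, b] (fun t => (F t i j * G t i' j')%:E).
Proof.
move=> hF hG; apply/integrable_mkcond => //.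
have := square_integrableM ((square_integrable_Lfun _).2 (hF i j))
   ((square_integrable_Lfun _).2 (hG i' j')).
apply: eq_integrable => // t _; rewrite !patchE.
by case: ifP => //; rewrite mul0r.
Qed.

Lemma mxL2_measurable (m q : nat) (F : R -> 'M[R]_(m, q)) i j : mxL2 a b F ->
  measurable_fun `[a, b] (fun t => F t i j).
Proof.
move=> hF; have [mF _] := (square_integrable_Lfun _).2 (hF i j).
by move/(measurable_restrict _ (measurable_itv `[a, b]) measurableT) : mF; rewrite setTI.
Qed.

Lemma mxL2_trunc (m q : nat) (F : R -> 'M[R]_(m, q)) (E : set R) :
  measurable E -> mxL2 a b F -> mxL2 a b (fun s => if s \in E then F s else 0).
Proof.
move=> mE hF i j; apply/square_integrable_Lfun.
have [mF iF] := (square_integrable_Lfun _).2 (hF i j).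
have -> : (fun t => (if t \in E then F t else 0) i j) \_ `[a, b] =
   ((fun t => F t i j) \_ `[a, b]) \_ E.
  by apply/funext => t; rewrite !patchE; case: ifP; case: ifP => //; rewrite mxE.
move: mF iF; set f := (fun t => F t i j) \_ _ => mF iF.
have m1 : measurable_fun setT (f \_ E).
  by apply/measurable_restrict => //; exact: measurable_funTS.
split => //; apply: le_integrable iF => //.
  by apply/measurable_EFinP; exact: measurable_funX.
move=> t _; rewrite lee_fin patchE; case: ifP => // _.
by rewrite expr0n normr0.
Qed.

Lemma integrable_inner (u v : R -> 'cV[R]_n) : mxL2 a b u -> mxL2 a b v ->
  mu.-integrable `[a, b] (fun s => (((u s)^T *m v s) ord0 ord0)%:E).
Proof.
move=> hu hv.
have : mu.-integrable `[a, b] (fun s => (\sum_i u s i ord0 * v s i ord0)%:E).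
  by apply: integrable_sumr => // i; exact: mxL2_integrableM.
apply: eq_integrable => // s _; congr EFin.
by rewrite mxE; apply: eq_bigr => i _; rewrite mxE.
Qed.

Lemma L2inner_ge0 (u : R -> 'cV[R]_n) : 0 <= L2inner a b u u.
Proof.
apply: Rintegral_ge0 => s _; rewrite mxE; apply: sumr_ge0 => i _.
by rewrite mxE -expr2 sqr_ge0.
Qed.

(** Cauchy-Schwarz: the squared norm of u + t v is a nonnegative polynomial in t, evaluated at its
    minimum, or affine when v has norm zero. *)
Lemma L2inner_sqr_le (u v : R -> 'cV[R]_n) : mxL2 a b u -> mxL2 a b v ->
  L2inner a b u v ^+ 2 <= L2inner a b u u * L2inner a b v v.
Proof.
move=> hu hv.
have iuu := integrable_inner hu hu; have iuv := integrable_inner hu hv.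
have ivv := integrable_inner hv hv.
have key t : 0 <= L2inner a b u u + t * (2 * L2inner a b u v) + t ^+ 2 * L2inner a b v v.
  have i2 : mu.-integrable `[a, b] (fun s => (t * 2 * ((u s)^T *m v s) ord0 ord0)%:E).
    exact: integrableZlr.
  have i3 : mu.-integrable `[a, b] (fun s => (t ^+ 2 * ((v s)^T *m v s) ord0 ord0)%:E).
    exact: integrableZlr.
  rewrite mulrA /L2inner -RintegralZl// -[X in _ + X]RintegralZl// -RintegralD// -RintegralD//.
    apply: Rintegral_ge0 => s _.
    have -> : ((u s)^T *m u s) ord0 ord0 + t * 2 * ((u s)^T *m v s) ord0 ord0 +
       t ^+ 2 * ((v s)^T *m v s) ord0 ord0 = \sum_i (u s i ord0 + t * v s i ord0) ^+ 2.
      rewrite !mxE !big_distrr/= -!big_split/=; apply: eq_bigr => i _.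
      by rewrite !mxE; ring.
    by apply: sumr_ge0 => i _; exact: sqr_ge0.
  exact: integrableDr.
have [vv0|vv0] := eqVneq (L2inner a b v v) 0.
  have := @affine_ge0_slope0 _ (L2inner a b u u) (2 * L2inner a b u v).
  move=> H; have : 2 * L2inner a b u v = 0.
    by apply: H => t; have := key t; rewrite vv0 mulr0 addr0.
  by move=> uv0; rewrite vv0 mulr0 (_ : L2inner a b u v = 0) ?expr0n//; lra.
have vvp : 0 < L2inner a b v v by rewrite lt_def vv0 L2inner_ge0.
have := key (- L2inner a b u v / L2inner a b v v).
set A := L2inner a b u u; set B := L2inner a b u v; set C := L2inner a b v v.
have -> : A + - B / C * (2 * B) + (- B / C) ^+ 2 * C = A - B ^+ 2 / C by field.
by rewrite subr_ge0 ler_pdivrMr.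
Qed.

Lemma L2inner_norm_le (u v : R -> 'cV[R]_n) : mxL2 a b u -> mxL2 a b v ->
  `|L2inner a b u v| <= L2norm a b u * L2norm a b v.
Proof.
move=> hu hv; rewrite -sqrtr_sqr /L2norm -sqrtrM ?L2inner_ge0//.
by apply: ler_wsqrtr; exact: L2inner_sqr_le.
Qed.

End limit.

Definition trunc (R : realType) (m n : nat) (E : set R) (F : R -> 'M[R]_(m, n))
    (s : R) : 'M[R]_(m, n) := if s \in E then F s else 0.

Lemma truncC (R : realType) (m n : nat) (E : set R) (F : R -> 'M[R]_(m, n)) s :
  F s = trunc E F s + trunc (~` E) F s.
Proof. by rewrite /trunc in_setC; case: (s \in E); rewrite ?addr0 ?add0r. Qed.

Lemma mxint_add (R : realType) (m n : nat) (D : set R) (F G : R -> 'M[R]_(m, n)) :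
  measurable D -> mxintegrable D F -> mxintegrable D G ->
  mxint D (fun t => F t + G t) = mxint D F + mxint D G.
Proof.
move=> mD iF iG; apply/matrixP => i j; rewrite !mxE -RintegralD//.
- by apply: eq_Rintegral => t _; rewrite mxE.
- exact: iF.
- exact: iG.
Qed.

(** The integrals are total functions and need not be additive on nonintegrable data, hence the four
    existence conditions at s. [PIop_bounded] supplies them for almost every s. *)
Lemma PIop_add (R : realType) (n : nat) (a b : R) (M : R -> 'M[R]_n)
    (N1 N2 : R -> R -> 'M[R]_n) (x u v : R -> 'cV[R]_n) (s : R) :
  (forall t, x t = u t + v t) ->
  mxintegrable `[a, s] (fun t => N1 s t *m u t) ->
  mxintegrable `[s, b] (fun t => N2 s t *m u t) ->
  mxintegrable `[a, s] (fun t => N1 s t *m v t) ->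
  mxintegrable `[s, b] (fun t => N2 s t *m v t) ->
  PIop a b M N1 N2 x s = PIop a b M N1 N2 u s + PIop a b M N1 N2 v s.
Proof.
move=> xuv i1 i2 j1 j2; rewrite /PIop.
have -> : (fun t => N1 s t *m x t) = (fun t => N1 s t *m u t + N1 s t *m v t).
  by apply/funext => t; rewrite xuv mulmxDr.
have -> : (fun t => N2 s t *m x t) = (fun t => N2 s t *m u t + N2 s t *m v t).
  by apply/funext => t; rewrite xuv mulmxDr.
rewrite !mxint_add// xuv mulmxDr [RHS]addrACA; congr (_ + _).
by rewrite [RHS]addrACA.
Qed.

Section truncation.
Context (R : realType) (a b : R) (n : nat).
Notation mu := (@lebesgue_measure R).
Variable x : R -> 'cV[R]_n.
Hypothesis hx : mxL2 a b x.

Let sqE (u : 'cV[R]_n) : (u^T *m u) ord0 ord0 = \sum_i u i ord0 ^+ 2.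
Proof. by rewrite mxE; apply: eq_bigr => i _; rewrite mxE expr2. Qed.

Let sq_trunc E s : ((trunc E x s)^T *m trunc E x s) ord0 ord0 <=
  ((x s)^T *m x s) ord0 ord0.
Proof.
rewrite /trunc; case: ifP => // _.
by rewrite mulmx0 [leLHS]mxE sqE; apply: sumr_ge0 => i _; exact: sqr_ge0.
Qed.

Lemma L2norm_trunc_le E : measurable E -> L2norm a b (trunc E x) <= L2norm a b x.
Proof.
move=> mE; apply: ler_wsqrtr; apply: le_Rintegral => //.
- by apply: integrable_inner; exact: mxL2_trunc.
- exact: integrable_inner.
Qed.

(** Dominated convergence: at each s the remainder is eventually 0, and its square stays below that
    of x. *)
Lemma L2norm_truncC_cvg0 (E : nat -> set R) e :
  (forall k, measurable (E k)) ->
  (forall s, a <= s <= b -> \forall k \near \oo, E k s) -> 0 < e ->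
  exists k, L2norm a b (trunc (~` E k) x) < e.
Proof.
move=> mE Eoo e0.
pose f k s := ((trunc (~` E k) x s)^T *m trunc (~` E k) x s) ord0 ord0.
have hf k : mu.-integrable `[a, b] (fun s => (f k s)%:E).
  by apply: integrable_inner; apply: mxL2_trunc => //; exact: measurableC.
have [] := @dominated_convergence _ _ _ mu `[a, b]%classic (measurable_itv `[a, b])
  (fun k s => (f k s)%:E) (cst 0%E) (fun s => (((x s)^T *m x s) ord0 ord0)%:E).
- by move=> k; exact: measurable_int (hf k).
- exact: measurable_cst.
- apply: aeW => s /=; rewrite in_itv/= => sab.
  apply: cvg_near_cst; near=> k.
  rewrite /f /trunc in_setC mem_set/=; first by rewrite mulmx0 mxE.
  by near: k; exact: Eoo.
- exact: integrable_inner.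
- apply: aeW => s /= k sab; rewrite lee_fin ger0_norm; first exact: sq_trunc.
  by rewrite /f sqE; apply: sumr_ge0 => i _; exact: sqr_ge0.
move=> _ _; rewrite integral0.
move=> /fine_cvgP[_] /cvgrPdist_lt /(_ (e ^+ 2)) [|k _ Hk]; first by rewrite exprn_gt0.
exists k; have /= := Hk k (leqnn k).
rewrite /= sub0r normrN -[fine _]/(L2inner a b (trunc (~` E k) x) (trunc (~` E k) x)).
rewrite ger0_norm ?L2inner_ge0// => lte.
by rewrite -[ltRHS]ger0_norm ?ltW// -sqrtr_sqr /L2norm ltr_sqrt// exprn_gt0.
Unshelve. all: by end_near.
Qed.

End truncation.

Lemma PIop_ge0_trunc (R : realType) (n : nat) (a b : R) (M : R -> 'M[R]_n)
    (N1 N2 : R -> R -> 'M[R]_n) (x : R -> 'cV[R]_n) (E : nat -> set R) :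
  PIop_bounded a b M N1 N2 -> mxL2 a b x ->
  (forall k, measurable (E k)) ->
  (forall s, a <= s <= b -> \forall k \near \oo, E k s) ->
  (forall k, 0 <= L2inner a b (trunc (E k) x) (PIop a b M N1 N2 (trunc (E k) x))) ->
  0 <= L2inner a b x (PIop a b M N1 N2 x).
Proof.
move=> [Bx [C BC]] hx mE Eoo pos.
pose B := PIop a b M N1 N2.
pose u k := trunc (E k) x; pose v k := trunc (~` E k) x.
have hu k : mxL2 a b (u k) by exact: mxL2_trunc.
have hv k : mxL2 a b (v k) by apply: mxL2_trunc => //; exact: measurableC.
have hB w : mxL2 a b w -> mxL2 a b (B w) by move=> /Bx[].
(* The left factor is split only against B u, so that each of the two error terms contains v exactly
   once. *)
have splitE k : L2inner a b x (B x) = L2inner a b (u k) (B (u k))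
    + L2inner a b (v k) (B (u k)) + L2inner a b x (B (v k)).
  rewrite /L2inner -RintegralD//; [|exact: integrable_inner (hB _ _)..].
  rewrite -RintegralD//; last 2 first.
  - by apply: integrableDr => //; apply: integrable_inner => //; exact: hB.
  - by apply: integrable_inner => //; exact: hB.
  apply: ae_eq_Rintegral => //.
  - apply/measurable_EFinP; apply: (measurable_int (@lebesgue_measure R)).
    by apply: integrable_inner => //; exact: hB.
  - apply/measurable_EFinP; apply: (measurable_int (@lebesgue_measure R)).
    by do 2?apply: integrableDr => //; apply: integrable_inner => //; exact: hB.
  have [aeu _] := Bx _ (hu k); have [aev _] := Bx _ (hv k).
  apply: (@filterS2 _ _ (ae_filter_ringOfSetsType (@lebesgue_measure R)) _ _ _ _ aeu aev).
  move=> s Hu Hv /= sab.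
  have [i1 i2] := Hu sab; have [j1 j2] := Hv sab.
  rewrite /B (PIop_add M (truncC (E k) x) i1 i2 j1 j2) -/B.
  have trD (w w' : 'cV[R]_n) : (w + w')^T = w^T + w'^T by rewrite linearD.
  rewrite mulmxDr [LHS]mxE {1}(truncC (E k) x s) trD mulmxDl.
  by rewrite [X in X + _]mxE.
have C0 w : mxL2 a b w -> L2norm a b (B w) <= `|C| * L2norm a b w.
  move=> /BC /le_trans; apply; apply: ler_wpM2r; last exact: ler_norm.
  exact: sqrtr_ge0.
rewrite leNgt; apply/negP => neg.
pose y := - L2inner a b x (B x).
(* The error terms add up to at most 2 |C| times the norms of x and v. The added 1 keeps [K]
   positive, so a norm of v below [y / K] makes their sum smaller than [y]. *)
pose K := 2 * `|C| * L2norm a b x + 1.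
have X0 : 0 <= L2norm a b x by exact: sqrtr_ge0.
have K0 : 0 < K by rewrite ltr_wpDl// !mulr_ge0.
have [|k vk] := L2norm_truncC_cvg0 hx mE Eoo (e := y / K).
  by rewrite divr_gt0// oppr_gt0.
have V0 : 0 <= L2norm a b (v k) by exact: sqrtr_ge0.
have b1 : `|L2inner a b (v k) (B (u k))| <= L2norm a b (v k) * (`|C| * L2norm a b x).
  apply: le_trans (L2inner_norm_le (hv k) (hB _ (hu k))) _.
  apply: ler_wpM2l => //; apply: le_trans (C0 _ (hu k)) _.
  by apply: ler_wpM2l => //; exact: L2norm_trunc_le.
have b2 : `|L2inner a b x (B (v k))| <= L2norm a b x * (`|C| * L2norm a b (v k)).
  apply: le_trans (L2inner_norm_le hx (hB _ (hv k))) _.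
  by apply: ler_wpM2l => //; exact: C0.
have yV : L2norm a b (v k) * K < y by rewrite -ltr_pdivlMr.
have := splitE k; have := pos k; rewrite -/B -/(u k).
move: b1 b2 yV V0; rewrite /y /K.
move: (L2inner a b x (B x)) (L2inner a b (u k) _) (L2inner a b (v k) _).
move: (L2inner a b x (B (v k))) (L2norm a b (v k)) (L2norm a b x) (`|C|).
move=> D V X c y0 A A' b1 b2 yV V0 A0 yE.
move: b1 b2; rewrite !ler_norml => /andP[b1 _] /andP[b2 _].
have tE : V * (2 * c * X + 1) = 2 * (V * (c * X)) + V by ring.
have tE' : X * (c * V) = V * (c * X) by ring.
rewrite tE in yV; rewrite tE' in b2; lra.
Qed.

(** * Measurability of matrix-valued functions *)

Section measurable_matrix.
Context d (T : measurableType d) (R : realType).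

Lemma measurable_mxM m q r (F : T -> 'M[R]_(m, q)) (G : T -> 'M[R]_(q, r)) :
  measurable_mx F -> measurable_mx G -> measurable_mx (fun t => F t *m G t).
Proof.
move=> mF mG i j.
rewrite (_ : (fun t => _) = (fun t => \sum_k F t i k * G t k j)).
  by apply: measurable_sum => k; exact: measurable_funM.
by apply/funext => t; rewrite mxE.
Qed.

Lemma measurable_mx_cst m q (A : 'M[R]_(m, q)) : measurable_mx (fun _ : T => A).
Proof. by move=> i j; exact: measurable_cst. Qed.

Lemma measurable_mx_if m q (c : T -> bool) (F G : T -> 'M[R]_(m, q)) :
  measurable_fun setT c -> measurable_mx F -> measurable_mx G ->
  measurable_mx (fun t => if c t then F t else G t).
Proof.
move=> mc mF mG i j.
rewrite (_ : (fun t => _) = (fun t => if c t then F t i j else G t i j)).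
  exact: measurable_fun_ifT.
by apply/funext => t; case: (c t).
Qed.

Lemma measurable_mx_trunc m q (E : set R) (F : R -> 'M[R]_(m, q)) :
  measurable E -> measurable_mx F -> measurable_mx (trunc E F).
Proof.
move=> mE mF i j.
rewrite (_ : (fun t => _) = (fun t => F t i j) \_ E).
  by apply/measurable_restrict => //; exact: measurable_funTS.
by apply/funext => t; rewrite patchE /trunc; case: ifP => //; rewrite mxE.
Qed.

Lemma measurable_sqrt_comp (f : T -> R) : measurable_fun setT f ->
  measurable_fun setT (fun t => Num.sqrt (f t)).
Proof.
move=> mf; apply: measurableT_comp mf => //.
exact: (continuous_measurable_fun (@sqrt_continuous R)).
Qed.

End measurable_matrix.

Section square_form_measurable.
Context (R : realType) (n q1 q2 p : nat).
Variables (Z1 : R -> 'M[R]_(q1, n)) (Z2 : R -> R -> 'M[R]_(q2, n)) (g : R -> R).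
Variables (L1 : 'M[R]_(p, q1)) (L2 L3 : 'M[R]_(p, q2)).
Notation mu := (@lebesgue_measure R).
Hypothesis mZ1 : measurable_mx Z1.
Hypothesis mZ2 : measurable_mx
  (fun v : measurableTypeR R * measurableTypeR R => Z2 v.1 v.2).
Hypothesis mg : measurable_fun setT g.

Lemma measurable_form_diag (x : R -> 'cV[R]_n) i : measurable_mx x ->
  measurable_fun setT (form_diag Z1 g L1 x i).
Proof.
move=> mx; apply: measurable_funM; first exact: measurable_sqrt_comp.
apply: measurable_mxM; first exact: measurable_mx_cst.
exact: measurable_mxM.
Qed.

Lemma measurable_form_kernel (x : R -> 'cV[R]_n) i : measurable_mx x ->
  measurable_fun setT (fun v : measurableTypeR R * measurableTypeR R =>
    form_kernel Z2 g L2 L3 x i v.1 v.2).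
Proof.
move=> mx; apply: measurable_funM.
  by apply: measurable_sqrt_comp; exact: measurableT_comp.
apply: measurable_mxM.
  apply: measurable_mx_if; [|exact: measurable_mx_cst|exact: measurable_mx_cst].
  by apply: measurable_fun_ltr.
apply: measurable_mxM => // j l.
exact: (measurableT_comp (mx j l) measurable_snd).
Qed.

End square_form_measurable.

(** * Truncation where the diagonal term and the columns are bounded *)

Section square_form_PIop.
Context (R : realType) (a b : R) (n q1 q2 p : nat).
Variables (Z1 : R -> 'M[R]_(q1, n)) (Z2 : R -> R -> 'M[R]_(q2, n)) (g : R -> R).
Variables (L1 : 'M[R]_(p, q1)) (L2 L3 : 'M[R]_(p, q2)).
Variables (M : R -> 'M[R]_n) (N1 N2 : R -> R -> 'M[R]_n).
Notation mu := (@lebesgue_measure R).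
Hypothesis mZ1 : measurable_mx Z1.
Hypothesis mZ2 : measurable_mx
  (fun v : measurableTypeR R * measurableTypeR R => Z2 v.1 v.2).
Hypothesis mg : measurable_fun setT g.
Hypothesis hg : forall s, 0 <= g s.
Hypothesis hg0 : forall s, ~ (a <= s <= b) -> g s = 0.
Hypothesis data : square_form_data a b Z1 Z2 g L1 L2 L3 M N1 N2.
Hypothesis hbdd : PIop_bounded a b M N1 N2.
Variable x : R -> 'cV[R]_n.
Hypothesis mx : measurable_mx x.
Hypothesis hx : mxL2 a b x.
Hypothesis hx0 : forall s, ~ (a <= s <= b) -> x s = 0.

Notation h u := (form_diag Z1 g L1 u).
Notation k u := (form_kernel Z2 g L2 L3 u).

(** For t = s the middle interval degenerates, and the blocks 33 on [a, s] and 22 on [s, b]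
    integrate the sum over all rows of the squares k_j(v, s)^2. This sum dominates each single
    square. *)
Let square_integrable_section i s : square_integrable mu (k x i ^~ s).
Proof.
have mk j : measurable_fun setT (k x j ^~ s).
  exact: (measurable_fun_pair1 s (measurable_form_kernel L2 L3 mZ2 mg j mx)).
split; first exact: mk.
have [/andP[as_ sb]|/negP ns] := boolP (a <= s <= b); last first.
  apply: eq_integrable (integrable0 _ _) => // v _.
  by rewrite /form_kernel hx0// !mulmx0 mxE mulr0 expr0n.
have [_ hint1 _ _ _] := data.
have [i1 _ i3] := hint1 s s as_ (lexx s) sb.
have [j1 _] := bilin_mxint (x s) (x s) (measurable_itv _) i1.
have [j3 _] := bilin_mxint (x s) (x s) (measurable_itv _) i3.
have mkk : measurable_fun setT (fun v => \sum_j k x j v s * k x j v s).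
  by apply: measurable_sum => j; apply: measurable_funM; exact: mk.
have [||ikk _] := Rintegral_itv_split as_ sb mkk j1 j3.
- move=> v /andP[av vs]; rewrite bilin_block//; apply: eq_bigr => j _.
  by rewrite /form_kernel ltNge (ltW vs).
- move=> v /andP[sv vb]; rewrite bilin_block//; apply: eq_bigr => j _.
  by rewrite /form_kernel sv.
have ikT : mu.-integrable setT (fun v => (\sum_j k x j v s * k x j v s)%:E).
  have ikk' : mu.-integrable setT
      ((fun v => (\sum_j k x j v s * k x j v s)%:E) \_ `[a, b]).
    by apply: ((integrable_mkcond _ _).1 ikk).
  apply: eq_integrable ikk' => // v _; rewrite patchE; case: ifPn => //.
  rewrite notin_setE/= in_itv/= => nv; rewrite big1// => j _.
  by rewrite /form_kernel hg0// sqrtr0 !mul0r.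
apply: le_integrable ikT => //.
  by apply/measurable_EFinP; apply: measurable_funX; exact: mk.
move=> v _; rewrite lee_fin ger0_norm ?sqr_ge0// ger0_norm; last first.
  by apply: sumr_ge0 => j _; rewrite -expr2 sqr_ge0.
by rewrite (bigD1 i)//= expr2 lerDl; apply: sumr_ge0 => j _; rewrite -expr2 sqr_ge0.
Qed.

(** By [square_integrable_section] these are genuine finite integrals, not the value 0 that [fine]
    gives to a divergent one; so a bound on [ksq] does control the columns. *)
Let ksq s := \sum_i \int[mu]_v (k x i v s ^+ 2).
Let hsq s := \sum_i h x i s ^+ 2.
Let E (l : nat) : set R := [set s | hsq s + ksq s <= l%:R].

Let mE l : measurable (E l).
Proof.
have mh : measurable_fun setT hsq.
  apply: measurable_sum => i; apply: measurable_funX.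
  exact: measurable_form_diag.
have mk : measurable_fun setT ksq.
  apply: measurable_sum => i; apply: measurableT_comp => //.
  have mki := measurable_form_kernel L2 L3 mZ2 mg i mx.
  apply: (@measurable_fun_fubini_tonelli_G _ _ _ _ _ mu
    (fun v => (k x i v.1 v.2 ^+ 2)%:E)).
    by apply/measurable_EFinP; exact: measurable_funX.
  by move=> v; rewrite lee_fin sqr_ge0.
have := measurable_funD mh mk measurableT (measurable_itv `]-oo, l%:R]).
by rewrite setTI; congr measurable; apply/seteqP; split => s /=; rewrite in_itv.
Qed.

Lemma square_form_PIop_ge0 : 0 <= L2inner a b x (PIop a b M N1 N2 x).
Proof.
apply: (PIop_ge0_trunc hbdd hx mE) => [s _|l].
  by near=> l; rewrite /E /=; near: l; exact: nbhs_infty_ger.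
have hxl : mxL2 a b (trunc (E l) x) by exact: mxL2_trunc.
have mxl : measurable_mx (trunc (E l) x) by exact: measurable_mx_trunc.
(* The set acts on h through v but on k through the second variable alone: columns are removed
   whole. *)
have hE i v : h (trunc (E l) x) i v = if v \in E l then h x i v else 0.
  rewrite /form_diag /trunc; case: ifP => // _.
  by rewrite !mulmx0 mxE mulr0.
have kE i v s : k (trunc (E l) x) i v s = if s \in E l then k x i v s else 0.
  rewrite /form_kernel /trunc; case: (s \in E l) => //.
  by rewrite !mulmx0 mxE mulr0.
have ksq0 s : 0 <= ksq s.
  by apply: sumr_ge0 => i _; apply: Rintegral_ge0 => v _; exact: sqr_ge0.
have hsq0 s : 0 <= hsq s by apply: sumr_ge0 => i _; exact: sqr_ge0.
have [aeB hB] := hbdd.1 _ hxl.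
have iI : mu.-integrable setT (fun s => (l%:R * \1_(`[a, b]%classic) s : R)%:E).
  by apply: integrableZlr => //; exact: (integrable_indic_itv a b true false).
have h2 i : square_integrable mu (h (trunc (E l) x) i).
  split; first exact: measurable_form_diag.
  apply: le_integrable iI => //.
    by apply/measurable_EFinP; apply: measurable_funX; exact: measurable_form_diag.
  move=> v _; rewrite lee_fin ger0_norm ?sqr_ge0// ger0_norm ?mulr_ge0//.
  have [vI|nvI] := boolP (v \in (`[a, b]%classic : set R)); last first.
    rewrite /form_diag hg0 ?sqrtr0 ?mul0r ?expr0n ?mulr_ge0//=.
    by move: nvI; rewrite notin_setE/= in_itv.
  rewrite indicE vI mulr1 hE; case: ifPn => [|_]; last by rewrite expr0n ler0n.
  rewrite inE /E /=; apply: le_trans.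
  apply: (@le_trans _ _ (hsq v)); last by rewrite lerDl.
  by rewrite /hsq (bigD1 i)//= lerDl; apply: sumr_ge0 => j _; exact: sqr_ge0.
have k2s i s : square_integrable mu (k (trunc (E l) x) i ^~ s).
  have [sE|nsE] := boolP (s \in E l).
    have -> : k (trunc (E l) x) i ^~ s = k x i ^~ s by apply/funext => v; rewrite kE sE.
    exact: square_integrable_section.
  have -> : k (trunc (E l) x) i ^~ s = cst 0.
    by apply/funext => v; rewrite kE (negbTE nsE).
  split; first exact: measurable_cst.
  by apply: eq_integrable (integrable0 _ _) => // v _; rewrite /= expr0n.
have k2c i s : \int[mu]_v (k (trunc (E l) x) i v s ^+ 2) <= l%:R.
  have [sE|nsE] := boolP (s \in E l); last first.
    under eq_Rintegral do rewrite kE (negbTE nsE) expr0n.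
    by rewrite Rintegral_cst// mul0r.
  under eq_Rintegral do rewrite kE sE.
  move: sE; rewrite inE /E /=; apply: le_trans.
  apply: (@le_trans _ _ (ksq s)); last by rewrite lerDr.
  rewrite /ksq (bigD1 i)//= lerDl; apply: sumr_ge0 => j _.
  by apply: Rintegral_ge0 => v _; exact: sqr_ge0.
have xl0 s : ~ (a <= s <= b) -> trunc (E l) x s = 0.
  by move=> ns; rewrite /trunc hx0//; case: ifP.
have mkl i := measurable_form_kernel L2 L3 mZ2 mg i mxl.
have myl i := mxL2_measurable i ord0 hB.
exact: (square_form_ge0 hg hg0 xl0 data h2 mkl k2s k2c mxl myl aeB).
Unshelve. all: by end_near.
Qed.

End square_form_PIop.

(** * Blocks of the matrix and extension by zero *)

Lemma block3_factor (R : realType) (q1 q2 : nat)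
    (P11 : 'M[R]_q1) (P12 P13 : 'M[R]_(q1, q2))
    (P21 : 'M[R]_(q2, q1)) (P22 P23 : 'M[R]_q2)
    (P31 : 'M[R]_(q2, q1)) (P32 P33 : 'M[R]_q2) :
  psdmx (block3_mx P11 P12 P13 P21 P22 P23 P31 P32 P33) ->
  exists (L1 : 'M[R]_(q1 + (q2 + q2), q1)) (L2 L3 : 'M[R]_(q1 + (q2 + q2), q2)),
    [/\ [/\ P11 = L1^T *m L1, P12 = L1^T *m L2 & P13 = L1^T *m L3],
        [/\ P21 = L2^T *m L1, P22 = L2^T *m L2 & P23 = L2^T *m L3] &
        [/\ P31 = L3^T *m L1, P32 = L3^T *m L2 & P33 = L3^T *m L3]].
Proof.
move=> /psdmx_factor[L H].
have : L = row_mx (lsubmx L) (row_mx (lsubmx (rsubmx L)) (rsubmx (rsubmx L))).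
  by rewrite !hsubmxK.
move: (lsubmx L) (lsubmx (rsubmx L)) (rsubmx (rsubmx L)) => L1 L2 L3 LE.
exists L1, L2, L3; move: H; rewrite LE !tr_row_mx mul_col_row mul_mx_row.
rewrite mul_col_row mul_col_mx.
move=> /eq_block_mx[-> /eq_row_mx[-> ->] /eq_col_mx[-> ->]].
by move=> /eq_block_mx[-> -> -> ->].
Qed.

Lemma eq_mxint (R : realType) (m n : nat) (D : set R) (F G : R -> 'M[R]_(m, n)) :
  (forall t, D t -> F t = G t) -> mxint D F = mxint D G.
Proof.
move=> FG; apply/matrixP => i j; rewrite !mxE; apply: eq_Rintegral => t.
by rewrite inE => Dt; rewrite FG.
Qed.

Lemma eq_mxintegrable (R : realType) (m n : nat) (D : set R)
    (F G : R -> 'M[R]_(m, n)) : measurable D ->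
  (forall t, D t -> F t = G t) -> mxintegrable D F -> mxintegrable D G.
Proof.
move=> mD FG iF i j; apply: eq_integrable (iF i j) => // t.
by rewrite inE => Dt; rewrite FG.
Qed.

Lemma L2inner_PIop_trunc (R : realType) (n : nat) (a b : R) (M : R -> 'M[R]_n)
    (N1 N2 : R -> R -> 'M[R]_n) (x : R -> 'cV[R]_n) :
  L2inner a b (trunc `[a, b] x) (PIop a b M N1 N2 (trunc `[a, b] x)) =
  L2inner a b x (PIop a b M N1 N2 x).
Proof.
have xE t : a <= t <= b -> trunc `[a, b] x t = x t.
  by move=> tab; rewrite /trunc mem_set//= in_itv.
apply: eq_Rintegral => s; rewrite inE/= in_itv/= => /[dup] sab /andP[as_ sb].
have E1 : mxint `[a, s] (fun t => N1 s t *m trunc `[a, b] x t) =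
    mxint `[a, s] (fun t => N1 s t *m x t).
  by apply: eq_mxint => t /=; rewrite in_itv/= => /andP[t1 t2]; rewrite xE// t1 (le_trans t2).
have E2 : mxint `[s, b] (fun t => N2 s t *m trunc `[a, b] x t) =
    mxint `[s, b] (fun t => N2 s t *m x t).
  by apply: eq_mxint => t /=; rewrite in_itv/= => /andP[t1 t2]; rewrite xE// t2 (le_trans as_).
have E0 : M s *m trunc `[a, b] x s = M s *m x s by rewrite xE.
have -> : PIop a b M N1 N2 (trunc `[a, b] x) s = PIop a b M N1 N2 x s.
  exact: (congr2 +%R (congr2 +%R E0 E1) E2).
by rewrite xE.
Qed.

Lemma square_form_data_restrict (R : realType) (a b : R) (n q1 q2 p : nat)
    (Z1 Z1' : R -> 'M[R]_(q1, n)) (Z2 Z2' : R -> R -> 'M[R]_(q2, n)) (g g' : R -> R)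
    (L1 : 'M[R]_(p, q1)) (L2 L3 : 'M[R]_(p, q2))
    (M : R -> 'M[R]_n) (N1 N2 : R -> R -> 'M[R]_n) :
  (forall s, a <= s <= b -> Z1' s = Z1 s) ->
  (forall s t, a <= s <= b -> a <= t <= b -> Z2' s t = Z2 s t) ->
  (forall s, a <= s <= b -> g' s = g s) ->
  square_form_data a b Z1 Z2 g L1 L2 L3 M N1 N2 ->
  square_form_data a b Z1' Z2' g' L1 L2 L3 M N1 N2.
Proof.
move=> e1 e2 eg [hM h1 h2 hN1 hN2].
have eI c d s t (A : 'M[R]_q2) v : a <= c -> d <= b -> a <= s <= b -> a <= t <= b ->
    `[c, d]%classic v ->
    g v *: ((Z2 v s)^T *m A *m Z2 v t) = g' v *: ((Z2' v s)^T *m A *m Z2' v t).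
  move=> ac db sab tab /=; rewrite in_itv/= => /andP[cv vd].
  have vab : a <= v <= b by rewrite (le_trans ac cv) (le_trans vd db).
  by rewrite eg// !e2.
have eII c d s t (A : 'M[R]_q2) : a <= c -> d <= b -> a <= s <= b -> a <= t <= b ->
    mxint `[c, d] (fun v => g v *: ((Z2 v s)^T *m A *m Z2 v t)) =
    mxint `[c, d] (fun v => g' v *: ((Z2' v s)^T *m A *m Z2' v t)).
  by move=> ac db sab tab; apply: eq_mxint => v; exact: eI.
have eIi c d s t (A : 'M[R]_q2) : a <= c -> d <= b -> a <= s <= b -> a <= t <= b ->
    mxintegrable `[c, d] (fun v => g v *: ((Z2 v s)^T *m A *m Z2 v t)) ->
    mxintegrable `[c, d] (fun v => g' v *: ((Z2' v s)^T *m A *m Z2' v t)).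
  by move=> ac db sab tab; apply: eq_mxintegrable => // v; exact: eI.
split=> [s sab|s t at_ ts sb|s t as_ st tb|s t at_ ts sb|s t as_ st tb].
- by rewrite hM// eg// e1.
- have [i1 i2 i3] := h1 s t at_ ts sb.
  have as_ := le_trans at_ ts; have tb := le_trans ts sb.
  have sab : a <= s <= b by rewrite as_. have tab : a <= t <= b by rewrite at_.
  by split; apply: eIi.
- have [i1 i2 i3] := h2 s t as_ st tb.
  have at_ := le_trans as_ st; have sb := le_trans st tb.
  have sab : a <= s <= b by rewrite as_. have tab : a <= t <= b by rewrite at_.
  by split; apply: eIi.
- have as_ := le_trans at_ ts; have tb := le_trans ts sb.
  have sab : a <= s <= b by rewrite as_. have tab : a <= t <= b by rewrite at_.
  by rewrite hN1// -!eII// !e2// !e1// !eg.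
- have at_ := le_trans as_ st; have sb := le_trans st tb.
  have sab : a <= s <= b by rewrite as_. have tab : a <= t <= b by rewrite at_.
  by rewrite hN2// -!eII// !e2// !e1// !eg.
Qed.

Theorem theorem7 (R : realType) (a b : R) (n q1 q2 : nat)
    (Z1 : R -> 'M[R]_(q1, n)) (Z2 : R -> R -> 'M[R]_(q2, n)) (g : R -> R)
    (P11 : 'M[R]_q1) (P12 P13 : 'M[R]_(q1, q2))
    (P21 : 'M[R]_(q2, q1)) (P22 P23 : 'M[R]_q2)
    (P31 : 'M[R]_(q2, q1)) (P32 P33 : 'M[R]_q2)
    (M : R -> 'M[R]_n) (N1 N2 : R -> R -> 'M[R]_n)
    (hab : a < b) (hn : (0 < n)%N)
    (hZ1 : mxL2 a b Z1) (hZ2 : mxL2_square a b Z2)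
    (hgm : measurable_fun `[a, b] g)
    (hg : forall s, s \in `[a, b] -> 0 <= g s)
    (hP : psdmx (block3_mx P11 P12 P13 P21 P22 P23 P31 P32 P33))
    (hint1 : forall s t, a <= t -> t <= s -> s <= b ->
       [/\ mxintegrable `[a, t]
             (fun v => g v *: ((Z2 v s)^T *m P33 *m Z2 v t)),
           mxintegrable `[t, s]
             (fun v => g v *: ((Z2 v s)^T *m P32 *m Z2 v t)) &
           mxintegrable `[s, b]
             (fun v => g v *: ((Z2 v s)^T *m P22 *m Z2 v t))])
    (hint2 : forall s t, a <= s -> s <= t -> t <= b ->
       [/\ mxintegrable `[a, s]
             (fun v => g v *: ((Z2 v s)^T *m P33 *m Z2 v t)),
           mxintegrable `[s, t]
             (fun v => g v *: ((Z2 v s)^T *m P23 *m Z2 v t)) &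
           mxintegrable `[t, b]
             (fun v => g v *: ((Z2 v s)^T *m P22 *m Z2 v t))])
    (hM : forall s, s \in `[a, b] ->
       M s = g s *: ((Z1 s)^T *m P11 *m Z1 s))
    (hN1 : forall s t, a <= t -> t <= s -> s <= b ->
       N1 s t =
         g s *: ((Z1 s)^T *m P12 *m Z2 s t)
         + g t *: ((Z2 t s)^T *m P31 *m Z1 t)
         + mxint `[a, t] (fun v => g v *: ((Z2 v s)^T *m P33 *m Z2 v t))
         + mxint `[t, s] (fun v => g v *: ((Z2 v s)^T *m P32 *m Z2 v t))
         + mxint `[s, b] (fun v => g v *: ((Z2 v s)^T *m P22 *m Z2 v t)))
    (hN2 : forall s t, a <= s -> s <= t -> t <= b ->
       N2 s t =
         g s *: ((Z1 s)^T *m P13 *m Z2 s t)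
         + g t *: ((Z2 t s)^T *m P21 *m Z1 t)
         + mxint `[a, s] (fun v => g v *: ((Z2 v s)^T *m P33 *m Z2 v t))
         + mxint `[s, t] (fun v => g v *: ((Z2 v s)^T *m P23 *m Z2 v t))
         + mxint `[t, b] (fun v => g v *: ((Z2 v s)^T *m P22 *m Z2 v t)))
    (hbdd : PIop_bounded a b M N1 N2)
    (x : R -> 'cV[R]_n) (hx : mxL2 a b x) :
  0 <= L2inner a b x (PIop a b M N1 N2 x).
Proof.
have [L1 [L2 [L3 [[e11 e12 e13] [e21 e22 e23] [e31 e32 e33]]]]] := block3_factor hP.
have data : square_form_data a b Z1 Z2 g L1 L2 L3 M N1 N2.
  split; rewrite -?e11 -?e12 -?e13 -?e21 -?e22 -?e23 -?e31 -?e32 -?e33.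
  - by move=> s sab; apply: hM.
  - exact: hint1.
  - exact: hint2.
  - exact: hN1.
  - exact: hN2.
(* The data are arbitrary outside [a, b]. Extended by zero they become measurable on the whole line
   and the square-form integrals can run over it, while [M], [N1] and [N2] stay the same. *)
pose Z1' := trunc `[a, b] Z1.
pose Z2' v s := if (v, s) \in (`[a, b] `*` `[a, b] : set (R * R)) then Z2 v s else 0.
pose g' := g \_ `[a, b].
have inI s : a <= s <= b -> s \in (`[a, b]%classic : set R).
  by move=> sab; rewrite mem_set//= in_itv.
have ninI s : ~ (a <= s <= b) -> (s \in (`[a, b]%classic : set R)) = false.
  by move=> sab; rewrite memNset//= in_itv.
have data' : square_form_data a b Z1' Z2' g' L1 L2 L3 M N1 N2.
  apply: square_form_data_restrict data => [s sab|s t sab tab|s sab].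
  - by rewrite /Z1' /trunc inI.
  - by rewrite /Z2' mem_set//=; split; rewrite /= in_itv.
  - by rewrite /g' patchE inI.
have mtrunc m q (F : R -> 'M[R]_(m, q)) : mxL2 a b F -> measurable_mx (trunc `[a, b] F).
  move=> hF i j; have [+ _] := (square_integrable_Lfun _).2 (hF i j).
  congr measurable_fun; apply/funext => t.
  by rewrite patchE /trunc; case: ifP => //; rewrite mxE.
rewrite -L2inner_PIop_trunc.
apply: (square_form_PIop_ge0 _ _ _ _ _ data' hbdd) => //.
- exact: mtrunc.
- move=> i j; have := hZ2 i j.
  rewrite inE => /andP[+ _]; rewrite inE /=.
  congr measurable_fun; apply/funext => -[v s].
  by rewrite patchE /Z2' /=; case: ifP => //; rewrite mxE.
- by apply/(measurable_restrict _ (measurable_itv _)) => //; rewrite setTI.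
- move=> s; rewrite /g' patchE; case: ifPn => // sI; apply: hg.
  by move: sI; rewrite inE.
- by move=> s /ninI; rewrite /g' patchE => ->.
- exact: mtrunc.
- exact: mxL2_trunc.
- by move=> s /ninI; rewrite /trunc => ->.
Qed.
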